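(* Let $(R,\mathcal{P})$ be a partially ordered commutative ring, let $\lambda,y_{\rm p},y_{\rm v},y_{\rm da},y_{\rm dd},y_{\rm fp}\in R$ satisfy $\lambda\ge0$, $\lambda y_{\rm fp}\ge\lambda y_{\rm p}$, $y_{\rm p}\ge0$, $y_{\rm v}\ge0$ and $y_{\rm da}+y_{\rm dd}\ge y_{\rm p}+y_{\rm v}$, and let $x$ be an indeterminate. Let $\widehat{\mathsf{L}}^{\flat}=(\widehat{\ell}^{\flat}_{n,k})_{n,k\ge0}$, $\widehat{\mathsf L}=(\widehat\ell_{n,k})$ be the matrices defined in the context (with $1+\alpha=\lambda$), and let $B_x=(\binom{i}{j}x^{i-j})_{i,j\ge0}$. Then: (a) $\widehat{\mathsf{L}}^{\flat}$ is totally positive in $R$. (b) $\widehat{\mathsf{L}}^{\flat}B_x$ is totally positive in $R[x]$ equipped with the coefficientwise order. (c) The sequence of row-generating polynomials $\widehat{\mathcal{L}}_n(x)=\sum_{k=0}^n\widehat{\ell}_{n,k}x^k$, $n\ge0$, is Hankel-totally positive in $R[x]$ equipped with the coefficientwise order. (d) The sequence of reversed row-generating polynomials $\overline{\widehat{\mathcal{L}}}_n(x)=\sum_{k=0}^n\widehat{\ell}_{n,k}x^{n-k}$, $n\ge0$, is Hankel-totally positive in $R[x]$ equipped with the coefficientwise order. These four statements also hold when the roles of $y_{\rm p}$ and $y_{\rm v}$ are interchanged (in the hypotheses).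
   Context: A partially ordered commutative ring is a commutative ring $R$ with $1\ne0$ together with a subset $\mathcal{P}$ (the nonnegative elements) such that $0,1\in\mathcal P$, $\mathcal P$ is closed under addition and multiplication, and $\mathcal P\cap(-\mathcal P)=\{0\}$; $a\le b$ means $b-a\in\mathcal P$. In $R[x]$ the coefficientwise order declares a polynomial nonnegative iff all its coefficients lie in $\mathcal P$. A matrix is totally positive if all its minors are nonnegative; a sequence $(a_n)$ is Hankel-totally positive if $(a_{i+j})_{i,j\ge0}$ is totally positive. A Laguerre digraph on $[n]=\{1,\dots,n\}$ is a directed graph (loops allowed) in which every vertex has out-degree $0$ or $1$ and in-degree $0$ or $1$; its weakly connected components are directed paths (possibly a single vertex) and directed cycles (possibly loops). $\mathbf{LD}_{n,k}$ denotes the set of Laguerre digraphs on $[n]$ with exactly $k$ path components, and ${\rm cyc}(G)$ the number of cycles of $G$. For $i\in[n]$, let $p(i)$ be the in-neighbour of $i$ if it exists and $0$ otherwise, and $s(i)$ the out-neighbour of $i$ if it exists and $0$ otherwise. Vertex $i$ is a peak if $p(i)<i>s(i)$, a valley if $p(i)>i<s(i)$, a double ascent if $p(i)<i<s(i)$, a double descent if $p(i)>i>s(i)$, a fixed point if $p(i)=i=s(i)$; ${\rm p}(G),{\rm v}(G),{\rm da}(G),{\rm dd}(G),{\rm fp}(G)$ are the respective numbers. Every path component contains at least one peak, so ${\rm p}(G)\ge k$ for $G\in\mathbf{LD}_{n,k}$. Define $$\widehat{\ell}_{n,k}=\sum_{G\in\mathbf{LD}_{n,k}}y_{\rm p}^{{\rm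 p}(G)}y_{\rm v}^{{\rm v}(G)}y_{\rm da}^{{\rm da}(G)}y_{\rm dd}^{{\rm dd}(G)}y_{\rm fp}^{{\rm fp}(G)}\lambda^{{\rm cyc}(G)},\qquad \widehat{\ell}^{\flat}_{n,k}=\sum_{G\in\mathbf{LD}_{n,k}}y_{\rm p}^{{\rm p}(G)-k}y_{\rm v}^{{\rm v}(G)}y_{\rm da}^{{\rm da}(G)}y_{\rm dd}^{{\rm dd}(G)}y_{\rm fp}^{{\rm fp}(G)}\lambda^{{\rm cyc}(G)} .$$ *)

(* Defs.v *)
From mathcomp Require Import all_boot all_order all_algebra.

Set Implicit Arguments.
Unset Strict Implicit.
Unset Printing Implicit Defensive.

Import GRing.Theory.
Local Open Scope ring_scope.

Record ordered_cone (R : comNzRingType) (P : R -> Prop) : Prop := OrderedCone {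
  cone0 : P 0;
  cone1 : P 1;
  coneD : forall a b, P a -> P b -> P (a + b);
  coneM : forall a b, P a -> P b -> P (a * b);
  cone_pointed : forall a, P a -> P (- a) -> a = 0
}.

Definition cone_le (R : comNzRingType) (P : R -> Prop) (a b : R) : Prop :=
  P (b - a).

Definition coefwise (R : comNzRingType) (P : R -> Prop) (p : {poly R}) : Prop :=
  forall i : nat, P p`_i.

Definition totally_positive (S : comNzRingType) (P : S -> Prop)
    (A : nat -> nat -> S) : Prop :=
  forall (r : nat) (f g : 'I_r -> nat),
    {homo f : i j / (i < j)%N} -> {homo g : i j / (i < j)%N} ->
    P (\det (\matrix_(i < r, j < r) A (f i) (g j))).

Definition hankel_totally_positive (S : comNzRingType) (P : S -> Prop)
    (a : nat -> S) : Prop :=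
  totally_positive P (fun i j => a (i + j)%N).

(* A digraph with loops on [n] is its set of edges (tail, head); the ordinal   *)
(* [i : 'I_n] stands for the vertex labelled [i.+1] of {1, ..., n}.            *)
Definition digraph (n : nat) := {set 'I_n * 'I_n}.

Section Digraphs.
Variables (n : nat) (G : digraph n).

Definition is_laguerre : bool :=
  [forall i, (#|[set j | (i, j) \in G]| <= 1)%N
          && (#|[set j | (j, i) \in G]| <= 1)%N].

Definition weak_adj : rel 'I_n := fun i j => ((i, j) \in G) || ((j, i) \in G).

Definition weak_components : {set {set 'I_n}} :=
  [set [set j | connect weak_adj i j] | i : 'I_n].

(* The subgraph induced on C is a directed path s_0 -> s_1 -> ... -> s_(m-1). *)
Definition is_path_on (C : {set 'I_n}) : bool :=
  [exists s : #|C|.-tuple 'I_n, ([set i in s] == C) &&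
    [forall i in C, forall j in C,
       ((i, j) \in G) == (index j s == (index i s).+1)]].

(* The same with the closing edge s_(m-1) -> s_0; a loop is the case m = 1.    *)
Definition is_cycle_on (C : {set 'I_n}) : bool :=
  [exists s : #|C|.-tuple 'I_n, ([set i in s] == C) &&
    [forall i in C, forall j in C,
       ((i, j) \in G) == (index j s == (index i s).+1 %% #|C|)%N]].

Definition npath : nat := #|[set C in weak_components | is_path_on C]|.
Definition ncyc : nat := #|[set C in weak_components | is_cycle_on C]|.

(* Labels in {1, ..., n} of the in- and out-neighbour, 0 when there is none.   *)
Definition p_label (i : 'I_n) : nat :=
  if [pick j | (j, i) \in G] is Some j then j.+1 else 0%N.
Definition s_label (i : 'I_n) : nat :=
  if [pick j | (i, j) \in G] is Some j then j.+1 else 0%N.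

Definition npeak : nat :=
  #|[set i : 'I_n | (p_label i < i.+1)%N && (s_label i < i.+1)%N]|.
Definition nvalley : nat :=
  #|[set i : 'I_n | (i.+1 < p_label i)%N && (i.+1 < s_label i)%N]|.
Definition ndasc : nat :=
  #|[set i : 'I_n | (p_label i < i.+1)%N && (i.+1 < s_label i)%N]|.
Definition nddesc : nat :=
  #|[set i : 'I_n | (i.+1 < p_label i)%N && (s_label i < i.+1)%N]|.
Definition nfix : nat :=
  #|[set i : 'I_n | (p_label i == i.+1) && (s_label i == i.+1)]|.

End Digraphs.

Definition LD (n k : nat) : {set digraph n} :=
  [set G : digraph n | is_laguerre G && (npath G == k)].

Section LaguerreMatrices.
Variables (R : comNzRingType) (lam yp yv yda ydd yfp : R).

Definition lhat (n k : nat) : R :=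
  \sum_(G in LD n k)
    yp ^+ npeak G * yv ^+ nvalley G * yda ^+ ndasc G * ydd ^+ nddesc G
    * yfp ^+ nfix G * lam ^+ ncyc G.

(* The subtraction does not truncate: each path component contains a peak.     *)
Definition lflat (n k : nat) : R :=
  \sum_(G in LD n k)
    yp ^+ (npeak G - k) * yv ^+ nvalley G * yda ^+ ndasc G * ydd ^+ nddesc G
    * yfp ^+ nfix G * lam ^+ ncyc G.

Definition Lhat_row (n : nat) : {poly R} :=
  \sum_(k < n.+1) (lhat n k)%:P * 'X^k.

Definition Lhat_row_rev (n : nat) : {poly R} :=
  \sum_(k < n.+1) (lhat n k)%:P * 'X^(n - k).

End LaguerreMatrices.

Definition binomial_mx (R : comNzRingType) (i j : nat) : {poly R} :=
  'C(i, j)%:R * 'X^(i - j).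

(* Product of infinite matrices whose left factor is lower triangular, so that *)
(* the terms with j > n vanish.                                                *)
Definition lt_mul (S : comNzRingType) (A B : nat -> nat -> S) (n k : nat) : S :=
  \sum_(j < n.+1) A n j * B j k.

Definition laguerre_hyp (R : comNzRingType) (P : R -> Prop)
    (lam yp yv yda ydd yfp : R) : Prop :=
  [/\ cone_le P 0 lam, cone_le P (lam * yp) (lam * yfp),
      cone_le P 0 yp, cone_le P 0 yv & cone_le P (yp + yv) (yda + ydd)].

(* Main.v *)
(* Deleting the vertex with the smallest label from a Laguerre digraph shows that the
   row polynomials L_n(u) = sum_k lflat_(n,k) u^k satisfy L_(n+1) = T L_n with
     T f = u (f + a f' + q f'') + b f + lambda q f',
   where a = yda + ydd, b = lambda yfp, q = yp yv; so lflat is the output matrix of the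
   tridiagonal production matrix of T. The substitution u -> u + x turns T into the operator
   with u replaced by u + x. When b = lambda yp, the matrix of the substituted operator is a
   product of three totally positive matrices; raising b by d multiplies the output matrix by
   the binomial matrix of d, which covers lambda yfp >= lambda yp. All four claims follow by
   the Cauchy-Binet formula, the Hankel ones because (M^(i+j))_00 = sum_k (M^i)_0k (M^j)_k0:
   part (c) uses x := yp x, and part (d) rescales all y's by x and uses x := yp. *)
Require Import Defs.
From HB Require Import structures.
From mathcomp Require Import all_boot all_order all_algebra all_fingroup fingraph zify ring.

Set Implicit Arguments.
Unset Strict Implicit.
Unset Printing Implicit Defensive.

Import GRing.Theory.
Local Open Scope ring_scope.

(** * Total positivity over an ordered cone *)

(** A general partially ordered ring has no division, so total positivity has to come from explicit
    factorizations with nonnegative entries. Write D for d/du and c for a - (yp + yv). When b =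
    lambda yp, the substituted operator equals ((u + x)(1 + yp D) + lambda yp)(1 + yv D) + c (u + x)
    D. This is the origin of the hypotheses: c >= 0 is yda + ydd >= yp + yv, and lambda yp is the
    constant that the factorization forces, so that lambda yfp may only exceed it. T itself involves
    yp and yv through their product alone, so interchanging their roles changes only how q is split.
    The smallest vertex is the one to delete because an absent neighbour has label 0: an old vertex
    that gains the new smallest vertex as a neighbour keeps all its comparisons, so only the type of
    the new vertex has to be recorded. Path and cycle counts become tractable through sources: a
    path component has exactly one, a cycle component none. *)

Section Cone.
Variables (S : comNzRingType) (P : S -> Prop).
Hypothesis HP : ordered_cone P.

Lemma cone_sum (I : Type) (r : seq I) (Q : pred I) (F : I -> S) :
  (forall i, Q i -> P (F i)) -> P (\sum_(i <- r | Q i) F i).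
Proof. by move=> h; apply: big_ind => //; [apply: cone0|apply: coneD]. Qed.

Lemma cone_prod (I : Type) (r : seq I) (Q : pred I) (F : I -> S) :
  (forall i, Q i -> P (F i)) -> P (\prod_(i <- r | Q i) F i).
Proof. by move=> h; apply: big_ind => //; [apply: cone1|apply: coneM]. Qed.

Lemma cone_natmul (a : S) n : P a -> P (a *+ n).
Proof.
move=> Pa; elim: n => [|n IH]; first by rewrite mulr0n; apply: cone0.
by rewrite mulrS; apply: coneD.
Qed.

Lemma cone_nat n : P n%:R.
Proof. exact/cone_natmul/(cone1 HP). Qed.

Lemma coefwise_cone : ordered_cone (coefwise P).
Proof.
split.
- by move=> i; rewrite coef0; apply: cone0.
- by move=> i; rewrite coef1; apply: cone_nat.
- by move=> a b Pa Pb i; rewrite coefD; apply: coneD.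
- by move=> a b Pa Pb i; rewrite coefM; apply: cone_sum => j _; apply: coneM.
- move=> a Pa Pna; apply/polyP => i; rewrite coef0; apply: (cone_pointed HP) => //.
  by rewrite -coefN.
Qed.

Lemma coefwise_polyC a : P a -> coefwise P a%:P.
Proof. by move=> Pa i; rewrite coefC; case: eqP => // _; apply: cone0. Qed.

Lemma coefwiseX : coefwise P 'X.
Proof. by move=> i; rewrite coefX; apply: cone_nat. Qed.

End Cone.

(** * Increasing selections and the Cauchy-Binet formula *)

Lemma ord_homo_mono (r : nat) (f : 'I_r -> nat) :
  {homo f : i j / (i < j)%N} -> {mono f : i j / (i < j)%N}.
Proof.
move=> hf i j; apply/idP/idP; last exact: hf.
case: (ltngtP i j) => // [/hf h1 /(ltn_trans h1)|/val_inj ->]; by rewrite ltnn.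
Qed.

Lemma ord_homo_inj (r : nat) (f : 'I_r -> nat) :
  {homo f : i j / (i < j)%N} -> injective f.
Proof.
move=> /ord_homo_mono hf i j fij; apply/val_inj.
by case: (ltngtP i j) => //; rewrite -hf fij ltnn.
Qed.

Lemma increasing_enum (N r : nat) (A : {set 'I_N}) : #|A| = r ->
  exists2 h : 'I_r -> 'I_N, {homo h : i j / (i < j)%N} & A = h @: setT.
Proof.
move=> <-; exists (@enum_val _ (mem A)); last first.
  apply/setP => x; apply/idP/imsetP => [xA|[i _ ->]]; last exact: enum_valP.
  by exists (enum_rank_in xA x) => //; rewrite enum_rankK_in.
move=> i j ij; have x0 : 'I_N := enum_val i.
rewrite !(enum_val_nth x0) -!(nth_map x0 0%N val) -?cardE //.
apply: (sorted_ltn_nth ltn_trans 0%N) => //; rewrite ?inE ?size_map -?cardE //.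
rewrite sorted_map /enum_mem -enumT; apply: sorted_filter.
  by move=> ? ? ?; apply: ltn_trans.
by rewrite -(sorted_map (f := val)) val_enum_ord iota_ltn_sorted.
Qed.

Lemma det_mul_rows (S : comNzRingType) (r N : nat) (A : 'M[S]_(r, N))
    (B : 'M[S]_(N, r)) :
  \det (A *m B) = \sum_(f : {ffun 'I_r -> 'I_N})
     (\prod_i A i (f i)) * \det (\matrix_(i, j) B (f i) j).
Proof.
under [RHS]eq_bigr do rewrite big_distrr /=.
rewrite exchange_big /=; apply: eq_bigr => s _.
under [RHS]eq_bigr do rewrite mulrCA.
rewrite -big_distrr /=; congr (_ * _).
under eq_bigr do rewrite mxE.
rewrite bigA_distr_bigA /=; apply: eq_bigr => f _.
by rewrite big_split /=; congr (_ * _); apply: eq_bigr => i _; rewrite mxE.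
Qed.

(* Cauchy-Binet: only the row selections f with an image of size r contribute, and those
   with a given image are the h \o s with h increasing and s a permutation. *)
Lemma det_mul_cone (S : comNzRingType) (P : S -> Prop) (r N : nat)
    (A : 'M[S]_(r, N)) (B : 'M[S]_(N, r)) :
  ordered_cone P ->
  (forall h : 'I_r -> 'I_N, {homo h : i j / (i < j)%N} ->
     P (\det (\matrix_(i, j) A i (h j))) /\
     P (\det (\matrix_(i, j) B (h i) j))) ->
  P (\det (A *m B)).
Proof.
move=> HP hAB; rewrite det_mul_rows.
rewrite (partition_big (fun f : {ffun _ -> _} => f @: [set: 'I_r]) predT) //=.
apply: cone_sum => // I _.
have [cI|cI] := eqVneq #|I| r; last first.
  rewrite big1; first exact: cone0.
  move=> f /eqP fI.
  have /injectivePn[i [j ij fij]] : ~~ injectiveb f.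
    apply: contra cI => /injectiveP fi.
    by rewrite -fI card_imset // cardsT card_ord.
  rewrite (determinant_alternate ij) ?mulr0 // => k.
  by rewrite !mxE fij.
have [h hh hI] := increasing_enum cI.
have hi : injective h by move=> i j /(congr1 val) /(ord_homo_inj hh).
have [PA PB] := hAB h hh.
rewrite (_ : \sum_(_ | _) _ = \det (\matrix_(i, j) A i (h j)) *
   \det (\matrix_(i, j) B (h i) j)); first exact: coneM.
have hpick y i j : h j = y -> odflt i [pick k | h k == y] = j.
  move=> <-; case: pickP => [k /eqP /hi //|/(_ j)]; by rewrite eqxx.
(* Inverse of [s -> h \o s]. Both defaults, [i] in [odflt] and the identity in [insubd], are out of
   reach as soon as [f] has image [I]: then every [f i] is some [h k], and [f] is injective by
   cardinality. *)
pose h' (f : {ffun 'I_r -> 'I_N}) : 'S_r :=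
  insubd (1%g : 'S_r) [ffun i => odflt i [pick k | h k == f i]].
rewrite (reindex (fun s : 'S_r => [ffun i => h (s i)])) /=; last first.
  exists h' => [s _|f]; last rewrite inE => /eqP fI.
    apply/permP => i; rewrite /h' -pvalE insubdK ?ffunE.
      by apply: hpick; rewrite ?ffunE.
    apply/injectiveP => x y; rewrite ffunE (hpick _ _ (s x)) ?ffunE //.
    by rewrite (hpick _ _ (s y)) ?ffunE // => /perm_inj.
  have fi : injective f.
    have /imset_injP fi : #|f @: [set: 'I_r]| == #|[set: 'I_r]|.
      by rewrite fI cI cardsT card_ord.
    by move=> x y; apply: fi; rewrite inE.
  have fh i : exists j, h j = f i.
    have : f i \in I by rewrite -fI imset_f.
    by rewrite hI => /imsetP[j _ ->]; exists j.
  apply/ffunP => i; rewrite ffunE /h' -pvalE insubdK ?ffunE.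
    by have [j hj] := fh i; rewrite (hpick _ _ j).
  apply/injectiveP => x y; rewrite !ffunE.
  have [j hj] := fh x; have [k hk] := fh y.
  by rewrite (hpick _ _ j) // (hpick _ _ k) // => jk; apply: fi; rewrite -hj -hk jk.
rewrite (eq_bigl predT) => [|s]; last first.
  apply/eqP; rewrite hI; apply/setP => x; apply/imsetP/imsetP => [[i _ ->]|[i _ ->]].
    by exists (s i); rewrite ?inE // ffunE.
  by exists (s^-1%g i); rewrite ?inE // ffunE permKV.
rewrite [X in _ = X * _]/determinant big_distrl /=; apply: eq_bigr => s _.
rewrite (_ : \matrix_(_, _) _ = row_perm s (\matrix_(i, j) B (h i) j)); last first.
  by apply/matrixP => i j; rewrite !mxE ffunE.
rewrite row_permE det_mulmx det_perm mulrA [_ * (-1) ^+ _]mulrC; congr (_ * _ * _).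
by apply: eq_bigr => i _; rewrite !mxE ?ffunE.
Qed.

Section TotalPositivity.
Variables (S : comNzRingType) (P : S -> Prop).
Hypothesis HP : ordered_cone P.

Definition trunc_mul (N : nat) (A B : nat -> nat -> S) (i k : nat) : S :=
  \sum_(j < N) A i j * B j k.

(** Stated for a single minor because [tp_krylov] knows, by induction, only the minors of the left
    factor with small row indices. *)
Lemma minor_trunc_mul N (A B : nat -> nat -> S) r (f g : 'I_r -> nat) :
  (forall h : 'I_r -> nat, {homo h : i j / (i < j)%N} ->
     P (\det (\matrix_(i, j) A (f i) (h j))) /\
     P (\det (\matrix_(i, j) B (h i) (g j)))) ->
  P (\det (\matrix_(i < r, j < r) trunc_mul N A B (f i) (g j))).
Proof.
move=> hAB.
rewrite (_ : \matrix_(_, _) _ = \matrix_(i < r, j < N) A (f i) j *m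
    \matrix_(i < N, j < r) B i (g j)); last first.
  by apply/matrixP => i j; rewrite !mxE; apply: eq_bigr => k _; rewrite !mxE.
apply: det_mul_cone => // h hh; have [PA PB] := hAB (fun i => h i) hh.
split; [move: PA|move: PB]; congr (P (\det _)); apply/matrixP => i j; by rewrite !mxE.
Qed.

Lemma tp_trunc_mul N (A B : nat -> nat -> S) :
  totally_positive P A -> totally_positive P B ->
  totally_positive P (trunc_mul N A B).
Proof.
move=> hA hB r f g hf hg; apply: minor_trunc_mul => h hh; split; [exact: hA|exact: hB].
Qed.

Lemma tp_ext (A B : nat -> nat -> S) :
  totally_positive P A -> (forall i j, A i j = B i j) -> totally_positive P B.
Proof.
move=> hA AB r f g hf hg; move: (hA r f g hf hg); congr (P (\det _)).
by apply/matrixP => i j; rewrite !mxE.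
Qed.

Lemma tp_tr (A : nat -> nat -> S) :
  totally_positive P A -> totally_positive P (fun i j => A j i).
Proof.
move=> hA r f g hf hg; rewrite -det_tr.
move: (hA r g f hg hf); congr (P (\det _)).
by apply/matrixP => i j; rewrite !mxE.
Qed.

Lemma ord_homo_ge_id r (f : 'I_r -> 'I_r) :
  {homo f : i j / (i < j)%N} -> forall i : 'I_r, (i <= f i)%N.
Proof.
move=> hf [k kr] /=; elim: k kr => // k IH kr.
apply: (leq_ltn_trans (IH (ltnW kr))); exact: hf.
Qed.

(** Without inversions both [s] and its inverse are increasing, hence both dominate the identity. *)
Lemma perm_inversion r (s : 'S_r) :
  s != 1%g -> exists i j : 'I_r, (i < j)%N /\ (s j < s i)%N.
Proof.
move=> s1; have [|h] := boolP [exists i : 'I_r, exists j : 'I_r, (i < j) && (s j < s i)]%N.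
  by move=> /existsP[i /existsP[j /andP[ij sij]]]; exists i, j.
case/eqP: s1; apply/permP => i; rewrite perm1.
have hs : {homo s : i j / (i < j)%N}.
  move=> x y xy; move: h => /existsPn/(_ x)/existsPn/(_ y); rewrite xy /= -leqNgt leq_eqVlt.
  by case/predU1P => // /val_inj/perm_inj e; rewrite e ltnn in xy.
have hs' : {homo s^-1%g : i j / (i < j)%N}.
  by move=> x y xy; rewrite -(ord_homo_mono hs) /= !permKV.
apply/val_inj/anti_leq/andP; split; last exact: ord_homo_ge_id.
by have := ord_homo_ge_id hs' (s i); rewrite permK.
Qed.

(* Every permutation other than the identity has an inversion, which kills its term. *)
Lemma tp_staircase (A : nat -> nat -> S) (lo : nat -> nat) :
  {homo lo : i j / (i <= j)%N} ->
  (forall i j, A i j = 0 \/ (lo i <= j <= lo i.+1)%N) ->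
  (forall i j, P (A i j)) -> totally_positive P A.
Proof.
move=> hlo hA PA r f g hf hg.
rewrite /determinant (bigD1 (1%g : 'S_r)) //= [X in _ + X]big1 => [|s s1]; last first.
  have [i [j [ij sij]]] := perm_inversion s1.
  have [z|hi] := hA (f i) (g (s i)).
    by rewrite (bigD1 i) //= mxE z mul0r mulr0.
  have [z|hj] := hA (f j) (g (s j)).
    by rewrite (bigD1 j) //= mxE z mul0r mulr0.
  (* If both entries survived, then g (s i) <= lo (f i + 1) <= lo (f j) <= g (s j), against g (s j)
     < g (s i). *)
  have := hg _ _ sij; have := hlo _ _ (hf _ _ ij); lia.
rewrite addr0 odd_perm1 expr0 mul1r; apply: cone_prod => // i _.
by rewrite mxE.
Qed.

(** Products of infinite matrices: [N0 i k] is a truncation order from which the entry (i, k) is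
    exact. A minor involves finitely many entries, so a single order serves all of them. *)
Lemma tp_mul (N0 : nat -> nat -> nat) (A B M : nat -> nat -> S) :
  totally_positive P A -> totally_positive P B ->
  (forall i k N, (N0 i k <= N)%N -> M i k = trunc_mul N A B i k) ->
  totally_positive P M.
Proof.
move=> hA hB hM r f g hf hg.
pose N := \max_(ij : 'I_r * 'I_r) N0 (f ij.1) (g ij.2).
rewrite (_ : \matrix_(_, _) _ = \matrix_(i < r, j < r) trunc_mul N A B (f i) (g j)).
  exact: tp_trunc_mul.
apply/matrixP => i j; rewrite !mxE; apply: hM.
exact: (leq_bigmax (F := fun ij : 'I_r * 'I_r => N0 (f ij.1) (g ij.2)) (i, j)).
Qed.

(** Row n + 1 of [K] is row n times [T], so [K] is the output matrix of [T]. Induction on a bound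
    for the row indices: if row 0 is not selected, lowering all rows by one and Cauchy-Binet split
    off a factor [T]; if it is selected, it is a unit vector and the minor is expanded along it. *)
Lemma tp_krylov (K T : nat -> nat -> S) :
  totally_positive P T -> (forall k, K 0%N k = (k == 0)%N%:R) ->
  (forall n k N, (n + k.+2 <= N)%N -> K n.+1 k = trunc_mul N K T n k) ->
  totally_positive P K.
Proof.
move=> hT K0 KS.
suff claim b r (f g : 'I_r -> nat) : (forall i, f i < b)%N ->
    {homo f : i j / (i < j)%N} -> {homo g : i j / (i < j)%N} ->
    P (\det (\matrix_(i < r, j < r) K (f i) (g j))).
  move=> r f g hf hg; apply: (claim (\max_(i < r) f i).+1) => // i.
  by rewrite ltnS; apply: (leq_bigmax (F := f)).
elim: b r f g => [|b IHb] r f g hb hf hg.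
  case: r f g hb hf hg => [|r] f g hb _ _; first by rewrite det_mx00; apply: cone1.
  by have := hb ord0.
have pos r' (f' g' : 'I_r' -> nat) : (forall i, 0 < f' i < b.+1)%N ->
    {homo f' : i j / (i < j)%N} -> {homo g' : i j / (i < j)%N} ->
    P (\det (\matrix_(i < r', j < r') K (f' i) (g' j))).
  move=> hb' hf' hg'.
  pose N := (\max_(i < r') f' i + (\max_(i < r') g' i).+2)%N.
  rewrite (_ : \matrix_(_, _) _ =
      \matrix_(i < r', j < r') trunc_mul N K T (f' i).-1 (g' j)).
    apply: (@minor_trunc_mul _ _ _ _ (fun i => (f' i).-1)) => h hh; split; last exact: hT.
    apply: (IHb _ (fun i => (f' i).-1)) => // [i|i j ij].
      by have := hb' i; lia.
    by have := hf' _ _ ij; have := hb' i; have := hb' j; lia.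
  apply/matrixP => i j; rewrite !mxE -(KS _ _ N) ?prednK //.
    by have /andP[] := hb' i.
  have fi : (f' i <= \max_(i < r') f' i)%N by apply: (leq_bigmax (F := f')).
  have gj : (g' j <= \max_(i < r') g' i)%N by apply: (leq_bigmax (F := g')).
  apply: leq_add => //. exact: (leq_trans (leq_pred _) fi).
case: r f g hb hf hg => [|r] f g hb hf hg; first by rewrite det_mx00; apply: cone1.
have [f0|f0] := posnP (f ord0); last first.
  apply: pos => // i; rewrite hb andbT.
  have [->//|i0] := eqVneq i ord0.
  apply: (leq_trans f0); apply/ltnW/hf; by rewrite lt0n.
(* Columns after the first have positive index, where row 0 of [K] vanishes. The corner entry is 1
   or 0 according to whether column 0 is selected, and its cofactor has positive rows only. *)
rewrite (expand_det_row _ ord0) (bigD1 ord0) //= big1 => [|j j0]; last first.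
  rewrite mxE f0 K0 (_ : (g j == 0)%N = false) ?mul0r //.
  apply/eqP => gj; have : (g ord0 < g j)%N by apply: hg; rewrite lt0n.
  by rewrite gj.
rewrite addr0 mxE f0 K0; apply: coneM => //; first exact: cone_nat.
rewrite /cofactor expr0 mul1r.
rewrite (_ : row' ord0 (col' ord0 _) =
    \matrix_(i < r, j < r) K (f (lift ord0 i)) (g (lift ord0 j))).
  apply: (pos _ (fun i => f (lift ord0 i)) (fun i => g (lift ord0 i))) => [i|i j ij|i j ij].
  - by rewrite hb andbT -f0; apply: hf.
  - exact: hf.
  - exact: hg.
by apply/matrixP => i j; rewrite !mxE.
Qed.

Lemma sum_ord_indicator N (a : nat) (F : nat -> S) :
  \sum_(j < N) (j == a :> nat)%:R * F j = (a < N)%:R * F a.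
Proof.
case: ltnP => aN.
  rewrite (bigD1 (Ordinal aN)) //= eqxx big1 ?addr0 // => j ja.
  by rewrite (_ : (j == a :> nat) = false) ?mul0r //; apply: contraNF ja.
rewrite mul0r big1 // => j _; rewrite (_ : (j == a :> nat) = false) ?mul0r //.
by apply/eqP => ja; have := ltn_ord j; rewrite ja ltnNge aN.
Qed.

Definition binomial_pow (c : S) (i j : nat) : S := 'C(i, j)%:R * c ^+ (i - j).

(** Pascal's rule makes this the output matrix of the bidiagonal matrix with [c] on the diagonal and
    1 above it. *)
Lemma tp_binomial_pow c : P c -> totally_positive P (binomial_pow c).
Proof.
move=> Pc.
pose T i j : S := (i == j)%:R * c + (i.+1 == j)%:R.
apply: (@tp_krylov _ T) => [|k|n k N nkN].
- apply: (@tp_staircase _ id) => // i j; rewrite /T.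
    case: (eqVneq i j) => [->|ij]; first by right; lia.
    case: (eqVneq i.+1 j) => [<-|ij']; first by right; lia.
    by left; rewrite mul0r addr0.
  by apply: (coneD HP); [apply: (coneM HP) => //|]; apply: cone_nat.
- by rewrite /binomial_pow bin0n sub0n expr0 mulr1 eq_sym.
rewrite /trunc_mul /T.
under eq_bigr => j _ do rewrite mulrDr mulrCA [_ * (_ == k)%:R]mulrC.
rewrite big_split /= (sum_ord_indicator _ _ (fun j => binomial_pow c n j * c)).
rewrite (_ : (k < N)%N = true) ?mul1r; last by lia.
rewrite /binomial_pow; case: k nkN => [|k] nkN.
  rewrite big1 => [|j _]; last by rewrite mul0r.
  by rewrite addr0 !bin0 !subn0 !mul1r exprSr.
under eq_bigr do rewrite eqSS.
rewrite (sum_ord_indicator _ _ (fun j => 'C(n, j)%:R * c ^+ (n - j))).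
rewrite (_ : (k < N)%N = true) ?mul1r; last by lia.
rewrite binS natrD mulrDl subSS -mulrA -exprSr; congr (_ + _).
have [kn|nk] := ltnP k n; first by rewrite subnSK.
by rewrite bin_small ?ltnS // !mul0r.
Qed.

End TotalPositivity.

(** * Production matrices *)

Section Moments.
Variables (S : comNzRingType) (P : S -> Prop).
Hypothesis HP : ordered_cone P.

Section Operator.
Variable T : {linear {poly S} -> {poly S}}.
Hypothesis size_T : forall f, (size (T f) <= (size f).+1)%N.
Hypothesis tp_T : totally_positive P (fun m k => (T 'X^m)`_k).

Lemma poly_sum_widen (f : {poly S}) N :
  (size f <= N)%N -> f = \sum_(m < N) f`_m *: 'X^m.
Proof.
move=> fN; apply/polyP => k; rewrite -poly_def coef_poly.
by case: ltnP => // /(leq_trans fN)/leq_sizeP ->.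
Qed.

Lemma size_iter_op n : (size (iter n T 1%R) <= n.+1)%N.
Proof.
by elim: n => [|n IH]; [rewrite size_poly1|apply: (leq_trans (size_T _))].
Qed.

Lemma tp_iter_op : totally_positive P (fun n k => (iter n T 1)`_k).
Proof.
apply: (tp_krylov HP tp_T) => [k|n k N nkN]; first by rewrite coef1.
rewrite /= {1}(@poly_sum_widen (iter n T 1) N); last first.
  by apply: (leq_trans (size_iter_op n)); lia.
by rewrite linear_sum coef_sum; apply: eq_bigr => m _; rewrite linearZ coefZ.
Qed.

Lemma iter_linear_sum j N (a : nat -> S) (g : nat -> {poly S}) :
  iter j T (\sum_(m < N) a m *: g m) = \sum_(m < N) a m *: iter j T (g m).
Proof.
elim: j => //= j ->.
by rewrite linear_sum; apply: eq_bigr => m _; rewrite linearZ.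
Qed.

Lemma iter_op_sum j (f : {poly S}) N : (size f <= N)%N ->
  (iter j T f)`_0 = \sum_(m < N) f`_m * (iter j T 'X^m)`_0.
Proof.
move=> fN; rewrite {1}(poly_sum_widen fN).
rewrite (iter_linear_sum j N (fun m => f`_m) (fun m => 'X^m)).
by rewrite coef_sum; apply: eq_bigr => m _; rewrite coefZ.
Qed.

(* The moments factor as (T^(i+j))_00 = sum_k (T^i)_0k (T^j)_k0. *)
Lemma hankel_iter_op : hankel_totally_positive P (fun n => (iter n T 1)`_0).
Proof.
apply: (@tp_mul _ _ HP (fun i k => i + k.+2)%N _ (fun m j => (iter j T 'X^m)`_0) _
    tp_iter_op); last first.
  move=> i j N ijN; rewrite addnC iterD (@iter_op_sum _ _ N) //.
  by apply: (leq_trans (size_iter_op i)); lia.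
pose K j m := (iter j T 'X^m)`_0.
(* [K] is again an output matrix, this time of the transpose of [T]: expanding the innermost
   application of [T] to 'X^m gives row n + 1 of [K] as row n times the transposed matrix. *)
apply: (@tp_tr _ _ K).
apply: (tp_krylov HP (tp_tr tp_T)) => [k|n k N nkN]; rewrite /K.
  by rewrite coefXn eq_sym.
rewrite iterSr (@iter_op_sum _ _ N); first by apply: eq_bigr => m _; rewrite mulrC.
by apply: (leq_trans (size_T _)); rewrite size_polyXn; lia.
Qed.

Variables (c : S) (T' : {poly S} -> {poly S}).
Hypothesis Pc : P c.
Hypothesis T'E : forall f, T' f = c *: f + T f.

(** Binomial theorem for the sum of [T] and the scalar [c], which commute. *)
Lemma iter_shift n N g : (n < N)%N ->
  iter n T' g = \sum_(j < N) binomial_pow c n j *: iter j T g.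
Proof.
move=> nN; elim: n nN => [|n IH] nN /=.
  rewrite (bigD1 (Ordinal nN)) //= /binomial_pow bin0n mul1r scale1r.
  rewrite big1 ?addr0 // => j j0; rewrite bin0n (_ : (j == 0 :> nat)%N = false) ?mul0r ?scale0r //.
  exact: contraNF j0.
case: N nN IH => // N nN IH.
rewrite T'E IH 1?ltnW // scaler_sumr linear_sum.
under [X in _ + X]eq_bigr => j _ do rewrite linearZ.
rewrite [X in X + _]big_ord_recl [X in _ + X]big_ord_recr [RHS]big_ord_recl /=.
rewrite [X in _ + (_ + X)](_ : _ = 0) ?addr0; last first.
  by rewrite /binomial_pow bin_small ?mul0r ?scale0r.
rewrite -addrA -big_split /=; congr (_ + _).
  by rewrite scalerA /binomial_pow !bin0 !mul1r !subn0 exprS.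
apply: eq_bigr => j _; rewrite scalerA -scalerDl; congr (_ *: _).
rewrite /binomial_pow /= binS natrD mulrDl subSS; congr (_ + _).
rewrite mulrCA -exprS.
have [jn|nj] := ltnP j n; first by rewrite subnSK.
by rewrite bin_small ?mul0r.
Qed.

Lemma tp_iter_shift : totally_positive P (fun n k => (iter n T' 1)`_k).
Proof.
apply: (@tp_mul _ _ HP (fun i k => i + k.+2)%N _ _ _
    (tp_binomial_pow HP Pc) tp_iter_op) => i k N ikN.
rewrite (@iter_shift _ N); last by lia.
by rewrite coef_sum; apply: eq_bigr => j _; rewrite coefZ.
Qed.

(** With H the Hankel matrix of the moments of [T] and B the binomial matrix of [c], the Hankel
    matrix for [T'] is B H B^T. Only [T] has to be totally positive. The auxiliary [M] is H B^T. *)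
Lemma hankel_iter_shift : hankel_totally_positive P (fun n => (iter n T' 1)`_0).
Proof.
pose M p j := \sum_(q < j.+1) (iter (p + q) T 1)`_0 * binomial_pow c j q.
have tpb := tp_binomial_pow HP Pc.
have widen p j N : (j < N)%N ->
    M p j = \sum_(q < N) (iter (p + q) T 1)`_0 * binomial_pow c j q.
  move=> jN; rewrite /M (big_ord_widen N (fun q => (iter (p + q) T 1)`_0 * binomial_pow c j q)) //.
  rewrite big_mkcond; apply: eq_bigr => q _; case: ifPn => //; rewrite -leqNgt => jq.
  by rewrite /binomial_pow bin_small // mul0r mulr0.
have tpM : totally_positive P M.
  apply: (@tp_mul _ _ HP (fun i k => i + k.+2)%N _ _ _
    hankel_iter_op (tp_tr tpb)) => i k N ikN.
  by apply: widen; lia.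
apply: (@tp_mul _ _ HP (fun i k => i + k.+2)%N _ _ _ tpb tpM) => i j N ijN.
rewrite iterD (@iter_shift i N) ?(@iter_shift j N); [|by lia..].
rewrite coef_sum; apply: eq_bigr => p _; rewrite coefZ; congr (_ * _).
rewrite (widen _ _ N); last by lia.
rewrite (iter_linear_sum p N (binomial_pow c j) (fun q => iter q T 1)).
by rewrite coef_sum; apply: eq_bigr => q _; rewrite coefZ -iterD mulrC.
Qed.

End Operator.
End Moments.

(** * The Laguerre operator *)

Section LaguerreOperator.
Variables (S : comNzRingType).

Section Def.
Variables (a b q l x : S).

Definition lag_op (f : {poly S}) : {poly S} :=
  ('X + x%:P) * (f + a *: f^`() + q *: f^`()^`()) + b *: f + (l * q) *: f^`().

Lemma lag_op_is_linear : linear lag_op.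
Proof.
move=> c f g; rewrite /lag_op !derivD !derivZ -!mul_polyC polyCM; ring.
Qed.

HB.instance Definition _ :=
  GRing.isLinear.Build S {poly S} {poly S} _ lag_op lag_op_is_linear.

Lemma coef_lag_op f k : (lag_op f)`_k =
  (if k is j.+1 then f`_j + a * (f`_j.+1 *+ j.+1) + q * (f`_j.+2 *+ j.+2 *+ j.+1) else 0)
  + x * (f`_k + a * (f`_k.+1 *+ k.+1) + q * (f`_k.+2 *+ k.+2 *+ k.+1))
  + b * f`_k + l * q * (f`_k.+1 *+ k.+1).
Proof.
rewrite /lag_op mulrDl !coefD coefXM coefCM !coefZ.
by case: k => [|k] /=; rewrite !(coefD, coefZ, coef_deriv).
Qed.

Lemma size_lag_op f : (size (lag_op f) <= (size f).+1)%N.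
Proof.
apply/leq_sizeP => -[//|k]; rewrite ltnS => fk.
have z j : (k <= j)%N -> f`_j = 0 by move=> kj; rewrite nth_default // (leq_trans fk).
by rewrite coef_lag_op !z; [rewrite !(mul0rn, mulr0, addr0)|lia..].
Qed.

End Def.

Lemma lag_op_comp a b q l x f :
  lag_op a b q l 0 f \Po ('X + x%:P) = lag_op a b q l x (f \Po ('X + x%:P)).
Proof.
have dX : ('X + x%:P)^`() = 1 by rewrite derivD derivX derivC addr0.
rewrite /lag_op !deriv_comp !derivM !dX !mulr1 derivC mulr0 addr0 !deriv_comp dX mulr1.
by rewrite !(comp_polyD, comp_polyM, comp_polyZ, comp_polyX, comp_polyC) ?addr0.
Qed.

(** Evaluation at [x] is the constant term after u -> u + x. This turns row polynomials at [x] into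
    moments, to which the Hankel criterion applies. *)
Lemma iter_lag_op_horner a b q l x n :
  (iter n (lag_op a b q l 0) 1).[x] = (iter n (lag_op a b q l x) 1)`_0.
Proof.
have -> : iter n (lag_op a b q l x) 1 = iter n (lag_op a b q l 0) 1 \Po ('X + x%:P).
  by elim: n => [|n /= ->]; rewrite ?comp_polyC // lag_op_comp.
by rewrite -horner_coef0 horner_comp !hornerE.
Qed.

Lemma lag_op_shift a b c q l x f :
  lag_op a (b + c) q l x f = c *: f + lag_op a b q l x f.
Proof. by rewrite /lag_op -!mul_polyC polyCD; ring. Qed.

Section Positivity.
Variable P : S -> Prop.
Hypothesis HP : ordered_cone P.
Variables (l x yp yv c : S).
Hypotheses (Pl : P l) (Px : P x) (Pyp : P yp) (Pyv : P yv) (Pc : P c).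

(* A, B, C are the edge layers of a planar network for lag_op; planarity is what makes
   each of them a staircase matrix. *)
Local Notation Xx := ('X + x%:P).

Let C (i : nat) : {poly S} := (if odd i then Xx else 1) * 'X^(i./2).

(** Node 2n stands for u^n and node 2n + 1 for (u + x) u^n. On even nodes this layer is (u + x)(1 +
    yp D) + l yp, with D the derivative; odd nodes pass straight through. *)
Let B (i j : nat) : S :=
  if odd i then (j == i)%:R
  else (j == i.+1)%:R + (j == i)%:R * (l * yp) + (j.+1 == i)%:R * (yp * i./2%:R).

(** The polynomials reached from node [i] through the layers [B] and [C]. At node 0 the truncated
    exponent is harmless, its weight being yp * 0. *)
Let BC (i : nat) : {poly S} :=
  Xx * 'X^(i./2) + (if odd i then 0
    else (l * yp) *: 'X^(i./2) + (yp * i./2%:R) *: (Xx * 'X^(i./2.-1))).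

(** The even targets realize 1 + yv D. The remaining term c (u + x) D goes to the odd node 2m - 1,
    where [B] is the identity, and so bypasses the second factor. *)
Let A (m i : nat) : S :=
  (i == m.*2)%:R + (i.+1 == m.*2)%:R * (c * m%:R) + (i.+2 == m.*2)%:R * (yv * m%:R).

Let coneD' := coneD HP.
Let coneM' := coneM HP.
Let cone_nat' := cone_nat HP.

Let tpC : totally_positive P (fun i k => (C i)`_k).
Proof.
have CE i k : (C i)`_k = if odd i then (k == i./2.+1)%:R + x * (k == i./2)%:R else (k == i./2)%:R.
  rewrite /C; case: (odd i); last by rewrite mul1r coefXn.
  by rewrite mulrDl -exprS coefD coefCM !coefXn.
apply: (@tp_staircase _ _ HP _ half) => i j; rewrite ?CE.
- exact: half_leq.
- case: ifP => oi.
    have [->|n1] := eqVneq j i./2.+1; first by right; lia.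
    have [->|n2] := eqVneq j i./2; first by right; lia.
    by left; rewrite mulr0 addr0.
  by have [->|n2] := eqVneq j i./2; [right; lia|left].
- by case: ifP => _; [apply: coneD' => //; apply: coneM' => //|].
Qed.

Let tpB : totally_positive P B.
Proof.
(* Row 2n occupies columns 2n - 1 to 2n + 1 and row 2n + 1 only column 2n + 1, so consecutive rows
   meet in odd columns. *)
apply: (@tp_staircase _ _ HP _ (fun i => (uphalf i).*2.-1)) => i j; rewrite /B.
- by lia.
- case: ifP => oi.
    have [->|n1] := eqVneq j i; first by right; lia.
    by left.
  have [->|n1] := eqVneq j i.+1; first by right; lia.
  have [->|n2] := eqVneq j i; first by right; lia.
  have [n3|n3] := eqVneq j.+1 i; first by right; lia.
  by left; rewrite !mul0r !addr0.
- by case: ifP => _ //; do 2?apply: coneD' => //; do 2?apply: coneM' => //.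
Qed.

Let tpA : totally_positive P A.
Proof.
apply: (@tp_staircase _ _ HP _ (fun i => i.*2 - 2)%N) => i j; rewrite /A.
- by lia.
- have [->|n1] := eqVneq j i.*2; first by right; lia.
  have [n2|n2] := eqVneq j.+1 i.*2; first by right; lia.
  have [n3|n3] := eqVneq j.+2 i.*2; first by right; lia.
  by left; rewrite !mul0r !addr0.
- by do 2?apply: coneD' => //; do 2?apply: coneM' => //.
Qed.

Let tpBC : totally_positive P (fun i k => (BC i)`_k).
Proof.
apply: (@tp_mul _ _ HP (fun i k => i.+2) _ _ _ tpB tpC) => i k N iN.
rewrite /trunc_mul /B /BC.
case: ifP => oi.
  rewrite (sum_ord_indicator _ _ (fun j => (C j)`_k)) ltnW // mul1r /C oi.
  by rewrite addr0.
under eq_bigr => j _ do rewrite !mulrDl -!mulrA.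
rewrite !big_split /= (sum_ord_indicator _ _ (fun j => (C j)`_k)).
rewrite (sum_ord_indicator _ _ (fun j => l * (yp * (C j)`_k))) iN ltnW // !mul1r.
rewrite addrA !coefD !coefZ {1 2}/C /= oi /= uphalf_half oi add0n mul1r !mulrA; congr (_ + _).
have [n def_i] : exists n, i = n.*2 by exists i./2; lia.
rewrite def_i doubleK in iN *; case: n iN {def_i} => [|n] iN.
  by rewrite !mulr0 mul0r big1 // => j _; rewrite !mul0r.
rewrite doubleS; under eq_bigr do rewrite eqSS.
rewrite (sum_ord_indicator _ _ (fun j => yp * (n.+1%:R * (C j)`_k))).
rewrite (_ : (n.*2.+1 < N)%N = true) ?mul1r; last by rewrite doubleS in iN; apply/ltnW/ltnW.
by rewrite {1}/C /= odd_double /= uphalf_double mulrA.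
Qed.

Lemma tp_lag_op :
  totally_positive P (fun m k => (lag_op (yp + yv + c) (l * yp) (yp * yv) l x 'X^m)`_k).
Proof.
apply: (@tp_mul _ _ HP (fun m k => m.*2.+1) _ _ _ tpA tpBC) => m k N mN.
rewrite /trunc_mul /A.
under eq_bigr => i _ do rewrite !mulrDl -!mulrA.
rewrite !big_split /= (sum_ord_indicator _ _ (fun i => (BC i)`_k)) mN mul1r.
case: m mN => [|m] mN.
  rewrite !big1 => [|i _|i _]; rewrite ?mul0r // !addr0 /BC /lag_op /=.
  rewrite expr0 -polyC1 !derivC !scaler0 !addr0 !mulr1 !mulr0 scale0r addr0.
  by rewrite -mul_polyC.
rewrite doubleS; under [X in _ = _ + X + _]eq_bigr do rewrite eqSS.
under [X in _ = _ + _ + X]eq_bigr do rewrite !eqSS.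
rewrite (sum_ord_indicator _ _ (fun i => c * (m.+1%:R * (BC i)`_k))).
rewrite (sum_ord_indicator _ _ (fun i => yv * (m.+1%:R * (BC i)`_k))).
rewrite doubleS in mN.
have mN1 : (m.*2.+1 < N)%N by exact: ltnW.
rewrite mN1 (ltnW mN1) !mul1r.
rewrite -!coefCM -!coefD; congr ((polyseq _)`_k).
rewrite /BC /= !odd_double /= !uphalf_double !doubleK /= /lag_op derivXn derivMn derivXn.
rewrite /= -!mul_polyC !polyCM !polyCD.
rewrite !polyC_natr exprS.
ring.
Qed.

Variable d : S.
Hypothesis Pd : P d.

Lemma hankel_lag_op : hankel_totally_positive P
  (fun n => (iter n (lag_op (yp + yv + c) (l * yp + d) (yp * yv) l 0) 1).[x]).
Proof.
have := hankel_iter_shift HP (size_lag_op _ _ _ _ _) tp_lag_op Pd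
  (lag_op_shift _ _ _ _ _ _).
by move=> h; apply: (tp_ext h) => i j; rewrite iter_lag_op_horner.
Qed.

End Positivity.

Lemma tp_iter_lag_op (P : S -> Prop) (l yp yv c d : S) : ordered_cone P ->
  P l -> P yp -> P yv -> P c -> P d ->
  totally_positive P (fun n k =>
    (iter n (lag_op (yp + yv + c) (l * yp + d) (yp * yv) l 0) 1)`_k).
Proof.
move=> HP Pl Pyp Pyv Pc Pd.
apply: (tp_iter_shift HP (size_lag_op _ _ _ _ _)
  (tp_lag_op HP Pl (cone0 HP) Pyp Pyv Pc) Pd) => f.
exact: lag_op_shift.
Qed.

(** The relation K_(n+1) = T K_n read on coefficients, at [x = 0]. The terms q u f'' and l q f'
    combine into the weight q (l + k)(k + 1). *)
Definition lag_rec (a b q l : S) (K : nat -> nat -> S) : Prop :=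
  (forall k, K 0%N k = (k == 0)%N%:R) /\
  (forall n k, K n.+1 k = (if k is j.+1 then K n j else 0) + (b + a *+ k) * K n k
      + q * (l + k%:R) * (K n k.+1 *+ k.+1)).

Lemma lag_rec_iter a b q l K : lag_rec a b q l K ->
  forall n k, K n k = (iter n (lag_op a b q l 0) 1)`_k.
Proof.
move=> [K0 KS]; elim=> [|n IH] k; first by rewrite K0 coef1.
rewrite KS [RHS]coef_lag_op mul0r addr0.
case: k => [|k]; rewrite !IH; ring.
Qed.

End LaguerreOperator.

Lemma size_iter_lag_op (S : comNzRingType) (a b q l : S) n :
  (size (iter n (lag_op a b q l 0%R) 1%R) <= n.+1)%N.
Proof. apply: size_iter_op => f; exact: size_lag_op. Qed.

(** * From the operator to arrays satisfying the recurrence *)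

Section Condition.
Variables (S : comNzRingType) (P : S -> Prop).
Hypothesis HP : ordered_cone P.

(** The splitting q = u v is existential, so both versions of the hypotheses are covered: (u, v) is
    (yp, yv) or (yv, yp). The two differences are the slacks c and d of the operator. *)
Definition lag_pos (a b q l : S) : Prop :=
  exists u v, [/\ P l, P u /\ P v, P (a - (u + v)), P (b - l * u) & q = u * v].

Lemma tp_lag_rec a b q l K :
  lag_pos a b q l -> lag_rec a b q l K -> totally_positive P K.
Proof.
move=> [u [v [Pl [Pu Pv] Pc Pd ->]]] /lag_rec_iter KE.
apply: (tp_ext (tp_iter_lag_op HP Pl Pu Pv Pc Pd)) => n k.
by rewrite KE !(addrC _ (_ - _)) !subrK.
Qed.

Lemma lag_rec_small (a b q l : S) (K : nat -> nat -> S) : lag_rec a b q l K ->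
  forall n k, (n < k)%N -> K n k = 0.
Proof.
move=> /lag_rec_iter KE n k nk; rewrite KE nth_default //.
exact: leq_trans (size_iter_lag_op _ _ _ _ _) nk.
Qed.

Lemma hankel_lag_rec a b q l x K :
  lag_pos a b q l -> lag_rec a b q l K -> P x ->
  hankel_totally_positive P (fun n => \sum_(k < n.+1) K n k * x ^+ k).
Proof.
move=> [u [v [Pl [Pu Pv] Pc Pd ->]]] /lag_rec_iter KE Px.
apply: (tp_ext (hankel_lag_op HP Pl Px Pu Pv Pc Pd)) => i j.
rewrite !(addrC _ (_ - _)) !subrK.
rewrite (horner_coef_wide _ (size_iter_lag_op _ _ _ _ _)).
by apply: eq_bigr => k _; rewrite KE.
Qed.

End Condition.

Section Polynomial.
Variables (R : comNzRingType) (P : R -> Prop) (a b q l yp : R) (K : nat -> nat -> R).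
Hypotheses (HP : ordered_cone P) (abql : lag_pos P a b q l) (recK : lag_rec a b q l K).
Hypothesis Pyp : P yp.

Let HPX := coefwise_cone HP.

Lemma tp_lag_rec_binomial :
  totally_positive (coefwise P) (lt_mul (fun n k => (K n k)%:P) (binomial_mx R)).
Proof.
have tpK : totally_positive (coefwise P) (fun n k => (K n k)%:P).
  move=> r f g hf hg.
  rewrite (_ : \matrix_(_, _) _ = map_mx polyC (\matrix_(i, j) K (f i) (g j))).
    by rewrite det_map_mx; apply: (coefwise_polyC HP); apply: (tp_lag_rec HP abql recK).
  by apply/matrixP => i j; rewrite !mxE.
apply: (@tp_mul _ _ HPX (fun n k => n.+1) _ _ _ tpK
  (tp_binomial_pow HPX (coefwiseX HP))) => n k N nN.
rewrite /lt_mul (big_ord_widen N (fun j => (K n j)%:P * binomial_mx R j k)) //.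
rewrite big_mkcond; apply: eq_bigr => j _; case: ifPn => //; rewrite -leqNgt => nj.
by rewrite (lag_rec_small recK) // polyC0 mul0r.
Qed.

Lemma hankel_row_poly : hankel_totally_positive (coefwise P)
  (fun n => \sum_(k < n.+1) (yp ^+ k * K n k)%:P * 'X^k).
Proof.
have pos : lag_pos (coefwise P) a%:P b%:P q%:P l%:P.
  have [u [v [Pl [Pu Pv] Pc Pd ->]]] := abql.
  exists u%:P, v%:P; rewrite -!(polyCD, polyCM, polyCN).
  by split; rewrite -?polyCB //; try split; apply: coefwise_polyC.
have rec : lag_rec a%:P b%:P q%:P l%:P (fun n k => (K n k)%:P).
  split => [k|n k]; first by rewrite recK.1 polyC_natr.
  rewrite recK.2 -!polyC_natr -!(polyCMn, polyCD, polyCM).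
  by case: k => [|k]; rewrite -?polyC0 -!polyCD.
have Px : coefwise P (yp%:P * 'X).
  by apply: (coneM HPX); [apply: coefwise_polyC|apply: coefwiseX].
apply: (tp_ext (hankel_lag_rec HPX pos rec Px)) => i j.
by apply: eq_bigr => k _; rewrite exprMn polyCM -polyC_exp; ring.
Qed.

(** The recurrence is homogeneous: with a and b of degree 1, q of degree 2 and l of degree 0,
    [K n k] has degree n - k. Scaling the parameters by 'X therefore multiplies it by 'X^(n - k),
    and evaluation at the constant [yp] gives the reversed polynomial. *)
Lemma hankel_row_poly_rev : hankel_totally_positive (coefwise P)
  (fun n => \sum_(k < n.+1) (yp ^+ k * K n k)%:P * 'X^(n - k)).
Proof.
have pos : lag_pos (coefwise P) (a%:P * 'X) (b%:P * 'X) (q%:P * 'X ^+ 2) l%:P.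
  have [u [v [Pl [Pu Pv] Pc Pd ->]]] := abql.
  have PX := coefwiseX HP.
  exists (u%:P * 'X), (v%:P * 'X); split; first exact: coefwise_polyC.
  - by split; apply: (coneM HPX) => //; apply: coefwise_polyC.
  - rewrite -mulrDl -mulrBl -polyCD -polyCB.
    by apply: (coneM HPX) => //; apply: coefwise_polyC.
  - rewrite mulrA -mulrBl -polyCM -polyCB.
    by apply: (coneM HPX) => //; apply: coefwise_polyC.
  - by rewrite polyCM; ring.
have rec : lag_rec (a%:P * 'X) (b%:P * 'X) (q%:P * 'X ^+ 2) l%:P
    (fun n k => (K n k)%:P * 'X^(n - k)).
  split => [k|n k].
    by rewrite recK.1 sub0n polyC_natr expr0 mulr1.
  (* Above the diagonal the truncated exponent n - k breaks homogeneity, but there the entries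
     vanish. *)
  have K0 := lag_rec_small recK.
  have -> : (b%:P * 'X + a%:P * 'X *+ k) * ((K n k)%:P * 'X^(n - k)) =
      ((b + a *+ k) * K n k)%:P * 'X^(n.+1 - k).
    have [nk|kn] := ltnP n k; first by rewrite K0 // mulr0 polyC0 !mul0r mulr0.
    by rewrite subSn // exprS !(polyCM, polyCD, polyCMn); ring.
  have -> : q%:P * 'X^2 * (l%:P + k%:R) * ((K n k.+1)%:P * 'X^(n - k.+1) *+ k.+1) =
      (q * (l + k%:R) * (K n k.+1 *+ k.+1))%:P * 'X^(n.+1 - k).
    have [nk|kn] := ltnP n k.+1; first by rewrite K0 // mul0rn mulr0 polyC0 !mul0r mul0rn mulr0.
    have -> : (n.+1 - k = (n - k.+1).+2)%N by lia.
    by rewrite !exprS !(polyCM, polyCD, polyCMn, polyC1); ring.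
  rewrite recK.2 !polyCD !mulrDl; congr (_ + _ + _).
  by case: k => [|k]; rewrite ?polyC0 ?mul0r // subSS.
apply: (tp_ext (hankel_lag_rec HPX pos rec (coefwise_polyC HP Pyp))) => i j.
by apply: eq_bigr => k _; rewrite polyCM -polyC_exp; ring.
Qed.

End Polynomial.

(** * Components of a Laguerre digraph *)

Local Close Scope ring_scope.

Lemma connect_invariant (T : finType) (e : rel T) (D : T -> Prop) x y :
  connect e x y -> D x ->
  (forall u v, connect e x u -> D u -> e u v -> D v) -> D y.
Proof.
move=> /connectP[p]; elim/last_ind: p y => [|p z IH] y; first by move=> _ ->.
rewrite rcons_path last_rcons => /andP[pp lz] -> Dx step.
apply: (step (last x p)) => //; first by apply/connectP; exists p.
exact: IH.
Qed.

Section Components.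
Variables (n : nat) (G : digraph n).

Definition sources : {set 'I_n} := [set i | [forall j, (j, i) \notin G]].
Definition sinks : {set 'I_n} := [set i | [forall j, (i, j) \notin G]].
Definition component (i : 'I_n) : {set 'I_n} := [set j | connect (weak_adj G) i j].

Lemma sourceP i : reflect (forall j, (j, i) \notin G) (i \in sources).
Proof. rewrite inE; exact: forallP. Qed.

Lemma sourcePn i : reflect (exists j, (j, i) \in G) (i \notin sources).
Proof.
rewrite inE; apply: (iffP forallPn) => -[j]; first by rewrite negbK; exists j.
by exists j; rewrite negbK.
Qed.

Lemma sinkP i : reflect (forall j, (i, j) \notin G) (i \in sinks).
Proof. rewrite inE; exact: forallP. Qed.

Lemma sinkPn i : reflect (exists j, (i, j) \in G) (i \notin sinks).
Proof.
rewrite inE; apply: (iffP forallPn) => -[j]; first by rewrite negbK; exists j.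
by exists j; rewrite negbK.
Qed.

Lemma laguerreP :
  reflect ((forall i j k, (i, j) \in G -> (i, k) \in G -> j = k) /\
           (forall i j k, (j, i) \in G -> (k, i) \in G -> j = k)) (is_laguerre G).
Proof.
apply: (iffP forallP) => [h|[h1 h2] i].
  split=> i j k ji ki; have /andP[/card_le1_eqP o /card_le1_eqP p] := h i.
    by apply: o; rewrite inE.
  by apply: p; rewrite inE.
apply/andP; split; apply/card_le1_eqP => j k; rewrite !inE => e1 e2.
  exact: h1 e2 e1.
exact: h2 e2 e1.
Qed.

Lemma weak_adj_sym : symmetric (weak_adj G).
Proof. by move=> i j; rewrite /weak_adj orbC. Qed.

Lemma weak_connect_sym : connect_sym (weak_adj G).
Proof. exact/sym_connect_sym/weak_adj_sym. Qed.

Lemma comp_refl i : i \in component i.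
Proof. by rewrite inE connect0. Qed.

Lemma comp_eq i j : j \in component i -> component j = component i.
Proof.
rewrite inE => ij; apply/setP => k; rewrite !inE.
exact/esym/(same_connect weak_connect_sym).
Qed.

Lemma comp_adj i j k : j \in component i -> weak_adj G j k -> k \in component i.
Proof. by rewrite !inE => ij jk; apply: (connect_trans ij); apply: connect1. Qed.

Lemma comp_succ i j k : j \in component i -> (j, k) \in G -> k \in component i.
Proof. by move=> ij jk; apply: (comp_adj ij); rewrite /weak_adj jk. Qed.

Lemma comp_pred i j k : j \in component i -> (k, j) \in G -> k \in component i.
Proof. by move=> ij jk; apply: (comp_adj ij); rewrite /weak_adj jk orbT. Qed.

Lemma weak_componentsP C : reflect (exists i, C = component i) (C \in weak_components G).
Proof.
apply: (iffP imsetP) => [[i _ ->]|[i ->]]; first by exists i.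
by exists i.
Qed.

Hypothesis lagG : is_laguerre G.

Let out_uniq i j k : (i, j) \in G -> (i, k) \in G -> j = k.
Proof. by case/laguerreP: lagG => h _; apply: h. Qed.

Let in_uniq i j k : (j, i) \in G -> (k, i) \in G -> j = k.
Proof. by case/laguerreP: lagG => _ h; apply: h. Qed.

(** Made total by fixing sinks, so that orbits and [findex] are available. A fixed point is thus
    either a loop or a sink. *)
Definition succ (i : 'I_n) : 'I_n := odflt i [pick j | (i, j) \in G].

Lemma edge_succ i j : (i, j) \in G -> succ i = j.
Proof.
move=> ij; rewrite /succ; case: pickP => [k ik|/(_ j)] /=; last by rewrite ij.
exact: out_uniq ik ij.
Qed.

Lemma succ_edge i : succ i != i -> (i, succ i) \in G.
Proof. by rewrite /succ; case: pickP => //= _; rewrite eqxx. Qed.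

Section Source.
Variable a : 'I_n.
Hypothesis src_a : a \in sources.

Let iter_edge m : (m.+1 < order succ a)%N -> (iter m succ a, iter m.+1 succ a) \in G.
Proof.
move=> mo; apply: succ_edge; apply/eqP => e.
have := findex_iter mo; rewrite iterS e findex_iter 1?ltnW //; lia.
Qed.

(** The orbit is closed under weak adjacency: forwards by construction, backwards because a point of
    the orbit other than [a] has its unique in-neighbour in the orbit, and [a] has none. *)
Lemma source_comp x : (x \in component a) = fconnect succ a x.
Proof.
apply/idP/idP; rewrite inE => ax; last first.
  apply: (connect_sub _ ax) => u v /eqP <-.
  have [->|uv] := eqVneq (succ u) u; first exact: connect0.
  by apply: connect1; rewrite /weak_adj succ_edge.
apply: (connect_invariant (D := fun z => fconnect succ a z) ax) => [|u v _ au].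
  exact: connect0.
case/orP => [/edge_succ <-|vu]; first exact: connect_trans au (fconnect1 _ _).
have := iter_findex au; have := findex_max au.
case: (findex succ a u) => [|m] mo /= e.
  by move/sourceP: src_a => /(_ v); rewrite e vu.
have := iter_edge mo; rewrite /= e => /in_uniq/(_ vu) <-; exact: fconnect_iter.
Qed.

Lemma source_edge x y : x \in component a -> y \in component a ->
  ((x, y) \in G) = (findex succ a y == (findex succ a x).+1).
Proof.
rewrite !source_comp => ax ay; apply/idP/eqP => [xy|e].
  have := iter_findex ay; have := findex_max ay.
  case: (findex succ a y) => [|m] mo /= e.
    by move/sourceP: src_a => /(_ x); rewrite e xy.
  have := iter_edge mo; rewrite /= e => /in_uniq/(_ xy) <-.
  by rewrite findex_iter // ltnW.
have := findex_max ay; rewrite e => /iter_edge.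
by rewrite iter_findex // -e iter_findex.
Qed.

Lemma source_uniq x : x \in component a -> x \in sources -> x = a.
Proof.
move=> ax /sourceP xs; have := ax; rewrite source_comp => fx.
have := iter_findex fx; have := findex_max fx.
case: (findex succ a x) => [//|m] mo e.
by have := iter_edge mo; rewrite e (negPf (xs _)).
Qed.

Lemma source_path : is_path_on G (component a).
Proof.
have sz : size (orbit succ a) == #|component a|.
  rewrite size_orbit /order; apply/eqP/eq_card => x.
  by rewrite source_comp.
apply/existsP; exists (Tuple sz); apply/andP; split.
  by apply/eqP/setP => x; rewrite inE source_comp fconnect_orbit.
apply/forallP => x; apply/implyP => ax; apply/forallP => y; apply/implyP => ay.
by rewrite source_edge.
Qed.

End Source.

(** The head of the listing has index 0, which is no successor, so no edge enters it. *)
Lemma path_source i : is_path_on G (component i) -> exists2 a, a \in sources & a \in component i.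
Proof.
case/existsP => s /andP[/eqP sC /forallP h].
have i0 : i \in (s : seq _) by have := comp_refl i; rewrite -{1}sC inE.
case E : (s : seq _) i0 => [//|a t] _.
have as_ : a \in tval s by rewrite E mem_head.
have ai : a \in component i by rewrite -sC inE.
exists a => //; apply/sourceP => j; apply/negP => ja.
have ji := comp_pred ai ja.
have := h j; rewrite ji => /forallP/(_ a); rewrite ai ja E /=.
by rewrite eqxx.
Qed.

Lemma cycle_sourceless i x : is_cycle_on G (component i) -> x \in component i -> x \notin sources.
Proof.
set C := component i; case/existsP => s /andP[/eqP sC /forallP h] Cx.
have us : uniq s.
  apply/card_uniqP; rewrite size_tuple -{2}sC; apply: eq_card => y; by rewrite inE.
have ix : index x s < #|C|.
  by rewrite -[X in _ < X](size_tuple s) index_mem; move: Cx; rewrite -{1}sC inE.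
(* The cyclic predecessor of the position of [x]; adding #|C| - 1 avoids a truncated subtraction. *)
pose k := (index x s + #|C|.-1) %% #|C|.
have C0 : 0 < #|C| by apply: leq_ltn_trans ix.
have kC : k < #|C| by rewrite ltn_mod.
pose y := nth x s k.
have ys : y \in tval s by rewrite mem_nth // size_tuple.
have Cy : y \in C by rewrite -sC inE.
have iy : index y s = k by rewrite index_uniq // size_tuple.
apply/sourcePn; exists y.
have := h y; rewrite Cy => /forallP/(_ x); rewrite Cx iy /= => /eqP ->.
rewrite /k -addn1 modnDml -addnA addn1 prednK // modnDr modn_small //.
Qed.

Section Sourceless.
Variable a : 'I_n.
Hypothesis noS : forall x, x \in component a -> x \notin sources.

(** Choosing in-neighbours is an injective self-map of a finite component, hence onto: every vertex
    is the in-neighbour of some vertex. *)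
Lemma sourceless_sink x : x \in component a -> x \notin sinks.
Proof.
pose pred y := odflt y [pick j | (j, y) \in G].
have predE y : y \in component a -> (pred y, y) \in G.
  move=> /noS/sourcePn[j jy]; rewrite /pred; case: pickP => [//|/(_ j)].
  by rewrite jy.
have pred_inj : {in component a &, injective pred}.
  by move=> y z /predE ey /predE ez e; rewrite e in ey; apply: out_uniq ey ez.
have predC : pred @: component a = component a.
  apply/eqP; rewrite eqEcard card_in_imset // leqnn andbT.
  apply/subsetP => _ /imsetP[y ay ->]; exact: comp_pred ay (predE _ ay).
rewrite -{1}predC => /imsetP[y ay ->]; apply/sinkPn; exists y; exact: predE.
Qed.

(** Extended by the identity to be injective on all of 'I_n, as [fconnect_sym] requires. [succ] can
    fail this elsewhere: a sink and its in-neighbour have the same image. *)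
Let f x := if x \in component a then succ x else x.

Let fE x : x \in component a -> (x, f x) \in G.
Proof.
move=> ax; rewrite /f ax; have /sinkPn[j xj] := sourceless_sink ax.
by rewrite (edge_succ xj).
Qed.

Let f_inj : injective f.
Proof.
have fC x : (f x \in component a) = (x \in component a).
  apply/idP/idP => [|ax]; last exact: comp_succ ax (fE ax).
  by rewrite /f; case: ifPn => // /negPf ->.
move=> x y e; have := fC x; rewrite e fC.
have [ax|ax] := boolP (x \in component a) => ay.
  by have := fE ax; rewrite e => /in_uniq; apply; apply: fE.
by move: e; rewrite /f (negPf ax) ay.
Qed.

Lemma sourceless_cycle : is_cycle_on G (component a).
Proof.
have cE x : (x \in component a) = fconnect f a x.
  apply/idP/idP; rewrite inE => ax; last first.
    apply: (connect_sub _ ax) => u v /eqP <-; rewrite /f.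
    case: ifP => [au|_]; last exact: connect0.
    by apply: connect1; rewrite /weak_adj; have := fE au; rewrite /f au => ->.
  apply: (connect_invariant (D := fun z => fconnect f a z) ax) => [|u v cu au].
    exact: connect0.
  have au' : u \in component a by rewrite inE.
  case/orP => [uv|vu].
    by apply: connect_trans au _; apply: connect1; rewrite /= (out_uniq uv (fE au')).
  have av := comp_pred au' vu.
  apply: (connect_trans au); rewrite fconnect_sym //; apply: connect1.
  by rewrite /= (out_uniq vu (fE av)).
have sz : size (orbit f a) == #|component a|.
  by rewrite size_orbit /order; apply/eqP/eq_card => x; rewrite cE.
apply/existsP; exists (Tuple sz); apply/andP; split.
  by apply/eqP/setP => x; rewrite inE cE fconnect_orbit.
apply/forallP => x; apply/implyP => ax; apply/forallP => y; apply/implyP => ay.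
rewrite -/(findex f a y) -/(findex f a x) -(eqP sz) size_orbit.
have fx : fconnect f a x by rewrite -cE.
have fy : fconnect f a y by rewrite -cE.
have -> : ((x, y) \in G) = (y == f x).
  by apply/idP/eqP => [xy|->]; [exact: out_uniq xy (fE ax)|exact: fE].
have <- : findex f a (f x) = (findex f a x).+1 %% order f a.
  rewrite -{1}(iter_findex fx) -iterS; have := findex_max fx.
  rewrite leq_eqVlt => /predU1P[->|lt]; last by rewrite findex_iter // modn_small.
  by rewrite iter_order // modnn findex0.
apply/eqP; apply/eqP/eqP => [->//|e].
rewrite -(iter_findex fy) e iter_findex //.
exact: connect_trans fx (fconnect1 _ _).
Qed.

End Sourceless.

(** Together with [sources_connect_uniq] this pairs the end of each path with its start, which later
    yields the factor [lam + k]. *)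
Lemma sinks_source b : b \in sinks -> exists2 a, a \in sources & connect (weak_adj G) b a.
Proof.
move=> sb.
have [|h] := boolP [exists x, (x \in component b) && (x \in sources)].
  case/existsP=> a /andP[ab sa].
  by exists a => //; move: ab; rewrite inE.
have noS x : x \in component b -> x \notin sources.
  by move=> bx; move/existsPn/(_ x): h; rewrite bx.
by have := sourceless_sink noS (comp_refl b); rewrite sb.
Qed.

Lemma sources_connect_uniq b a a' : a \in sources -> a' \in sources ->
  connect (weak_adj G) b a -> connect (weak_adj G) b a' -> a = a'.
Proof.
move=> sa sa' ba ba'; apply/esym/(source_uniq sa) => //.
by rewrite inE (connect_trans _ ba') // weak_connect_sym.
Qed.

Lemma npathE : npath G = #|sources|.
Proof.
rewrite /npath -(card_in_imset (f := component) (D := mem sources)); last first.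
  move=> x y sx sy e; apply: (sources_connect_uniq (b := x)) => //.
  by have := comp_refl y; rewrite -e inE.
apply: eq_card => C; rewrite inE; apply/andP/imsetP => [[/weak_componentsP[i ->]]|[a sa ->]].
  by case/path_source => a sa /comp_eq <-; exists a.
by split; [apply/weak_componentsP; exists a|exact: source_path].
Qed.

Definition cycle_comps : {set {set 'I_n}} :=
  [set C in weak_components G | [disjoint C & sources]].

Lemma ncycE : ncyc G = #|cycle_comps|.
Proof.
apply: eq_card => C; rewrite !inE; apply: andb_id2l => /weak_componentsP[i ->].
apply/idP/idP => [cC|/disjointFr dC].
  by apply/pred0P => x /=; apply/negbTE/negP => /andP[/(cycle_sourceless cC)/negP].
by apply: sourceless_cycle => x /dC ->.
Qed.

(** Both projections are injective on edges, so each side is n minus the number of edges. *)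
Lemma card_sinks : #|sinks| = #|sources|.
Proof.
have -> : sinks = ~: [set e.1 | e in G].
  apply/setP => i; rewrite [in RHS]inE; apply/sinkP/idP => [h|h j].
    by apply/imsetP => -[[x y] xy /= e]; have := h y; rewrite e xy.
  by apply: contra h => ij; apply/imsetP; exists (i, j).
have -> : sources = ~: [set e.2 | e in G].
  apply/setP => i; rewrite [in RHS]inE; apply/sourceP/idP => [h|h j].
    by apply/imsetP => -[[x y] xy /= e]; have := h x; rewrite e xy.
  by apply: contra h => ij; apply/imsetP; exists (j, i).
rewrite [LHS]cardsCs [RHS]cardsCs !setCK !card_in_imset // => -[x y] [z t] xy zt /= e.
  by rewrite e in xy *; rewrite (in_uniq xy zt).
by rewrite e in xy *; rewrite (out_uniq xy zt).
Qed.

End Components.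

(** * Adding a vertex of smallest label *)

Lemma card_set_ordS n (Q : pred 'I_n.+1) :
  #|[set i | Q i]| = Q ord0 + #|[set i | Q (lift ord0 i)]|.
Proof.
rewrite -!sum1dep_card big_mkcond big_ord_recl [in RHS]big_mkcond /=.
by case: (Q ord0).
Qed.

Lemma exists_ordS n (Q : pred 'I_n.+1) :
  [exists i, Q i] = Q ord0 || [exists i, Q (lift ord0 i)].
Proof.
apply/existsP/orP => [[i]|[Q0|/existsP[i Qi]]].
- by case: (unliftP ord0 i) => [j ->|->] Qi; [right; apply/existsP; exists j|left].
- by exists ord0.
- by exists (lift ord0 i).
Qed.

Lemma forall_ordS n (Q : pred 'I_n.+1) :
  [forall i, Q i] = Q ord0 && [forall i, Q (lift ord0 i)].
Proof. by rewrite -[LHS]negbK negb_forall exists_ordS negb_or -negb_forall !negbK. Qed.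

Section Labels.
Variables (n : nat) (G : digraph n).
Hypothesis lagG : is_laguerre G.

Lemma p_labelE i :
  (p_label G i = 0 /\ i \in sources G) \/
  exists j : 'I_n, [/\ p_label G i = j.+1, (j, i) \in G & forall k, (k, i) \in G -> k = j].
Proof.
rewrite /p_label; case: pickP => [j ji|h]; [right|left].
  by exists j; split=> // k ki; case/laguerreP: lagG => _; apply; [exact: ki|].
by split => //; apply/sourceP => j; rewrite h.
Qed.

Lemma s_labelE i :
  (s_label G i = 0 /\ i \in sinks G) \/
  exists j : 'I_n, [/\ s_label G i = j.+1, (i, j) \in G & forall k, (i, k) \in G -> k = j].
Proof.
rewrite /s_label; case: pickP => [j ji|h]; [right|left].
  by exists j; split=> // k ki; case/laguerreP: lagG => + _; apply; [exact: ki|].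
by split => //; apply/sinkP => j; rewrite h.
Qed.

(** Tests that fail at label 0 become existentials over neighbours, which are easy to compare before
    and after adding a vertex. Tests that hold at 0 are reached by negation. *)
Lemma p_label_test (T : rel nat) (i : 'I_n) : T i.+1 0 = false ->
  T i.+1 (p_label G i) = [exists j : 'I_n, ((j, i) \in G) && T i.+1 j.+1].
Proof.
move=> T0; case: (p_labelE i) => [[-> /sourceP h]|[j [-> ji h]]].
  by rewrite T0; apply/esym/existsP => -[j]; rewrite (negPf (h j)).
by apply/idP/existsP => [t|[k /andP[/h ->]]//]; exists j; rewrite ji.
Qed.

Lemma s_label_test (T : rel nat) (i : 'I_n) : T i.+1 0 = false ->
  T i.+1 (s_label G i) = [exists j : 'I_n, ((i, j) \in G) && T i.+1 j.+1].
Proof.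
move=> T0; case: (s_labelE i) => [[-> /sinkP h]|[j [-> ji h]]].
  by rewrite T0; apply/esym/existsP => -[j]; rewrite (negPf (h j)).
by apply/idP/existsP => [t|[k /andP[/h ->]]//]; exists j; rewrite ji.
Qed.

End Labels.

Section Extension.
Variable n : nat.

(* How vertex 0 is attached to a digraph on the other vertices: [None] for a loop,
   [Some (p, s)] for an optional in-neighbour [p] and an optional out-neighbour [s]. *)
Definition attachment : finType := option (option 'I_n * option 'I_n).

Definition inn (c : attachment) : option 'I_n := if c is Some (p, _) then p else None.
Definition outn (c : attachment) : option 'I_n := if c is Some (_, s) then s else None.

Definition ext (G : digraph n) (c : attachment) : digraph n.+1 :=
  [set e | match unlift ord0 e.1, unlift ord0 e.2 with
           | Some i, Some j => (i, j) \in G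
           | Some i, None => inn c == Some i
           | None, Some j => outn c == Some j
           | None, None => c == None
           end].

Definition restr (G : digraph n.+1) : digraph n :=
  [set e | (lift ord0 e.1, lift ord0 e.2) \in G].

Definition attach (G : digraph n.+1) : attachment :=
  if (ord0, ord0) \in G then None
  else Some ([pick i | (lift ord0 i, ord0) \in G], [pick j | (ord0, lift ord0 j) \in G]).

Definition attachable (G : digraph n) (c : attachment) : bool :=
  (if inn c is Some i then i \in sinks G else true) &&
  (if outn c is Some j then j \in sources G else true).

Local Notation L := (lift ord0).

Lemma extE G c : ((forall i j, ((L i, L j) \in ext G c) = ((i, j) \in G)) *
  (forall i, ((L i, ord0) \in ext G c) = (inn c == Some i)) *
  (forall j, ((ord0, L j) \in ext G c) = (outn c == Some j)) *
  (((ord0, ord0) \in ext G c) = (c == None)))%type.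
Proof.
by do 3?split=> *; rewrite inE /= ?liftK ?unlift_none.
Qed.

Lemma restr_ext G c : restr (ext G c) = G.
Proof. by apply/setP => -[i j]; rewrite inE extE. Qed.

Lemma pick_eq_Some (T : finType) (o : option T) : [pick i | o == Some i] = o.
Proof.
case: pickP => [i /eqP //|]; case: o => // x /(_ x); by rewrite eqxx.
Qed.

Lemma attach_ext G c : attach (ext G c) = c.
Proof.
rewrite /attach extE; case: c => [[p s]|] //=.
under eq_pick do rewrite extE /=; rewrite pick_eq_Some.
by under eq_pick do rewrite extE /=; rewrite pick_eq_Some.
Qed.

Lemma ext_laguerre G c : is_laguerre (ext G c) = is_laguerre G && attachable G c.
Proof.
apply/laguerreP/andP => [[ho hi]|[lag /andP[hc1 hc2]]].
  split.
    apply/laguerreP; split=> i j k ij ik; apply: (@lift_inj _ ord0).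
      by apply: (ho (L i)); rewrite extE.
    by apply: (hi (L i)); rewrite extE.
  apply/andP; split.
    case E : (inn c) => [i|//]; apply/sinkP => j; apply/negP => ij.
    have := ho (L i) ord0 (L j); rewrite !extE E eqxx ij => /(_ isT isT) e.
    by have := neq_lift ord0 j; rewrite -e eqxx.
  case E : (outn c) => [i|//]; apply/sourceP => j; apply/negP => ij.
  have := hi (L i) ord0 (L j); rewrite !extE E eqxx ij => /(_ isT isT) e.
  by have := neq_lift ord0 j; rewrite -e eqxx.
have /laguerreP[ho hi] := lag.
have vin i j : inn c == Some i -> (i, j) \notin G.
  by move=> /eqP E; move: hc1; rewrite E => /sinkP.
have vout i j : outn c == Some i -> (j, i) \notin G.
  by move=> /eqP E; move: hc2; rewrite E => /sourceP.
have c0i i : c == None -> (inn c == Some i) = false by move=> /eqP ->.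
have c0o i : c == None -> (outn c == Some i) = false by move=> /eqP ->.
split=> x y z; case: (unliftP ord0 x) => [i|] ->; case: (unliftP ord0 y) => [j|] ->;
  case: (unliftP ord0 z) => [k|] -> //; rewrite ?extE.
- by move=> h1 h2; rewrite (ho _ _ _ h1 h2).
- by move=> h1 /(vin _ j); rewrite h1.
- by move=> /(vin _ k) h1; rewrite (negPf h1).
- by move=> /eqP -> /eqP[->].
- by move=> h1 /(c0o j); rewrite h1.
- by move=> /(c0o k) ->.
- by move=> h1 h2; rewrite (hi _ _ _ h1 h2).
- by move=> h1 /(vout _ j); rewrite h1.
- by move=> /(vout _ k) h1; rewrite (negPf h1).
- by move=> /eqP -> /eqP[->].
- by move=> h1 /(c0i j); rewrite h1.
- by move=> /(c0i k) ->.
Qed.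

(** [attach] keeps one neighbour on each side, and none beside a loop; the degree bounds ensure that
    nothing is lost. *)
Lemma ext_restr G : is_laguerre G -> ext (restr G) (attach G) = G.
Proof.
move=> /laguerreP[ho hi]; apply/setP => -[x y].
case: (unliftP ord0 x) => [i|] ->; case: (unliftP ord0 y) => [j|] ->; rewrite extE.
- by rewrite inE.
- rewrite /attach; case: ifP => h00 /=.
    apply/esym/negP => h; have e := hi _ _ _ h h00.
    by have := neq_lift ord0 i; rewrite e eqxx.
  case: pickP => [k hk|h]; last by rewrite h.
  by apply/eqP/idP => [[<-]//|hj]; congr Some; apply: (@lift_inj _ ord0); apply: hi hk hj.
- rewrite /attach; case: ifP => h00 /=.
    apply/esym/negP => h; have e := ho _ _ _ h h00.
    by have := neq_lift ord0 j; rewrite e eqxx.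
  case: pickP => [k hk|h]; last by rewrite h.
  by apply/eqP/idP => [[<-]//|hj]; congr Some; apply: (@lift_inj _ ord0); apply: ho hk hj.
- by rewrite /attach; case: ifP.
Qed.

Section Stats.
Variables (G : digraph n) (c : attachment).
Hypotheses (lagG : is_laguerre G) (attGc : attachable G c).

Let H := ext G c.
Let lagH : is_laguerre H. Proof. by rewrite ext_laguerre lagG. Qed.

(** The first two conditions say that the test treats label 1, the new vertex, like label 0, an
    absent neighbour; the third is invariance under the shift of labels. *)
Let label_lift (T : rel nat) (i : 'I_n) : (forall x, T x.+1 0 = false) ->
  (forall x, T x.+2 1 = false) -> (forall x y, T x.+2 y.+2 = T x.+1 y.+1) ->
  (T (L i).+1 (p_label H (L i)) = T i.+1 (p_label G i)) *
  (T (L i).+1 (s_label H (L i)) = T i.+1 (s_label G i)).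
Proof.
move=> T0 T1 TS; split.
  rewrite !p_label_test // exists_ordS lift0 T1 andbF orFb.
  by apply: eq_existsb => j; rewrite extE lift0 TS.
rewrite !s_label_test // exists_ordS lift0 T1 andbF orFb.
by apply: eq_existsb => j; rewrite extE lift0 TS.
Qed.

Let lt_lift (i : 'I_n) :
  (((L i).+1 < p_label H (L i)) = (i.+1 < p_label G i)) *
  (((L i).+1 < s_label H (L i)) = (i.+1 < s_label G i)).
Proof. exact: (label_lift (T := ltn)). Qed.

Let gt_lift (i : 'I_n) :
  ((p_label H (L i) < (L i).+1) = (p_label G i < i.+1)) *
  ((s_label H (L i) < (L i).+1) = (s_label G i < i.+1)).
Proof. by rewrite !(ltnNge _ i.+1) !(ltnNge _ (L i).+1) !(label_lift (T := leq)). Qed.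

Let eq_lift (i : 'I_n) :
  ((p_label H (L i) == (L i).+1) = (p_label G i == i.+1)) *
  ((s_label H (L i) == (L i).+1) = (s_label G i == i.+1)).
Proof.
rewrite !(eq_sym _ i.+1) !(eq_sym _ (L i).+1).
exact: (label_lift (T := fun x y => x == y)).
Qed.

Let exists_eq_Some (T : finType) (o : option T) (b : bool) :
  [exists i, (o == Some i) && b] = b && (o != None).
Proof.
apply/existsP/andP => [[i /andP[/eqP -> //]]|[-> ]].
by case: o => // i _; exists i; rewrite eqxx.
Qed.

Let label0 (T : rel nat) (b : bool) : T 1 0 = false -> (forall x, T 1 x.+2 = b) ->
  (T 1 (p_label H ord0) = (c == None) && T 1 1 || b && (inn c != None)) *
  (T 1 (s_label H ord0) = (c == None) && T 1 1 || b && (outn c != None)).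
Proof.
move=> T0 TS; split.
  rewrite (@p_label_test _ _ lagH T ord0) // exists_ordS extE; congr (_ || _).
  rewrite -exists_eq_Some; apply: eq_existsb => j; by rewrite extE lift0 TS.
rewrite (@s_label_test _ _ lagH T ord0) // exists_ordS extE; congr (_ || _).
rewrite -exists_eq_Some; apply: eq_existsb => j; by rewrite extE lift0 TS.
Qed.

Let lt0 : ((1 < p_label H ord0) = (inn c != None)) * ((1 < s_label H ord0) = (outn c != None)).
Proof.
by move: (@label0 ltn true erefl (fun=> erefl)); rewrite /= !andbF.
Qed.

Let gt0 : ((p_label H ord0 < 1) = (c != None) && (inn c == None)) *
  ((s_label H ord0 < 1) = (c != None) && (outn c == None)).
Proof.
by rewrite !(ltnNge _ 1) !(label0 (T := leq) (b := true)) // !andbT !negb_or !negbK.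
Qed.

Let eq0 : ((p_label H ord0 == 1) = (c == None)) * ((s_label H ord0 == 1) = (c == None)).
Proof.
rewrite !(eq_sym _ 1).
by move: (@label0 (fun x y => x == y) false erefl (fun=> erefl)); rewrite /= !andbT !orbF.
Qed.

Lemma npeak_ext : npeak H = (c == Some (None, None)) + npeak G.
Proof.
rewrite /npeak card_set_ordS !gt0; congr (_ + _).
  by case: (c) => [[[?|] [?|]]|].
by apply: eq_card => i; rewrite !inE !gt_lift.
Qed.

Lemma nvalley_ext : nvalley H = (inn c != None) && (outn c != None) + nvalley G.
Proof.
rewrite /nvalley card_set_ordS !lt0; congr (_ + _).
by apply: eq_card => i; rewrite !inE !lt_lift.
Qed.

Lemma ndasc_ext : ndasc H = (inn c == None) && (outn c != None) + ndasc G.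
Proof.
rewrite /ndasc card_set_ordS !lt0 !gt0; congr (_ + _).
  by case: (c) => [[[?|] [?|]]|].
by apply: eq_card => i; rewrite !inE !lt_lift !gt_lift.
Qed.

Lemma nddesc_ext : nddesc H = (inn c != None) && (outn c == None) + nddesc G.
Proof.
rewrite /nddesc card_set_ordS !lt0 !gt0; congr (_ + _).
  by case: (c) => [[[?|] [?|]]|].
by apply: eq_card => i; rewrite !inE !lt_lift !gt_lift.
Qed.

Lemma nfix_ext : nfix H = (c == None) + nfix G.
Proof.
rewrite /nfix card_set_ordS !eq0 andbb; congr (_ + _).
by apply: eq_card => i; rewrite !inE !eq_lift.
Qed.

Lemma source_ext0 : (ord0 \in sources H) = (c != None) && (inn c == None).
Proof.
rewrite inE forall_ordS extE; congr (_ && _).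
apply/forallP/eqP => [h|e i]; last by rewrite extE e.
by case E : (inn c) => [i|//]; have := h i; rewrite extE E eqxx.
Qed.

Lemma source_extL i : (L i \in sources H) = (i \in sources G) && (outn c != Some i).
Proof.
rewrite inE forall_ordS extE andbC inE; congr (_ && _).
by apply: eq_forallb => j; rewrite extE.
Qed.

(** Vertex 0 is a new source unless something enters it, and its out-neighbour stops being one. The
    additive form avoids truncation. *)
Lemma npath_ext : npath H + (outn c != None) = (c != None) && (inn c == None) + npath G.
Proof.
rewrite !npathE //.
have -> : #|sources H| = #|[set i | i \in sources H]| by apply: eq_card => i; rewrite inE.
rewrite card_set_ordS source_ext0 -addnA; congr (_ + _).
have /andP[_ hc2] := attGc.
case E : (outn c) hc2 => [j|] sj.
  rewrite addn1 (cardsD1 j (sources G)) sj add1n; congr _.+1; apply: eq_card => i.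
  by rewrite inE source_extL E in_setD1 andbC (inj_eq Some_inj) eq_sym.
rewrite addn0; apply: eq_card => i; by rewrite inE source_extL E andbT.
Qed.

(** Whether vertex 0 lies on a cycle: it carries a loop, or it joins the end of a path to the start
    of the same path. Joining two distinct paths merges them instead. *)
Definition closes : bool :=
  match c with
  | None => true
  | Some (Some i, Some j) => connect (weak_adj G) i j
  | _ => false
  end.

Let inn_sink i : inn c = Some i -> i \in sinks G.
Proof. by move=> E; have /andP[] := attGc; rewrite E. Qed.

Let outn_source j : outn c = Some j -> j \in sources G.
Proof. by move=> E; have /andP[] := attGc; rewrite E. Qed.

Let adj_LL i j : weak_adj H (L i) (L j) = weak_adj G i j.
Proof. by rewrite /weak_adj !extE. Qed.

Let adj_L0 i : weak_adj H (L i) ord0 = (inn c == Some i) || (outn c == Some i).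
Proof. by rewrite /weak_adj !extE. Qed.

Let adj_0L i : weak_adj H ord0 (L i) = (inn c == Some i) || (outn c == Some i).
Proof. by rewrite weak_adj_sym adj_L0. Qed.

Let connect_lift i j : connect (weak_adj G) i j -> connect (weak_adj H) (L i) (L j).
Proof.
move=> ij; apply: (connect_invariant (D := fun z => connect (weak_adj H) (L i) (L z)) ij).
  exact: connect0.
by move=> u v _ iu uv; apply: (connect_trans iu); apply: connect1; rewrite adj_LL.
Qed.

Let comp_lift i : (forall k, k \in component G i -> ~~ weak_adj H (L k) ord0) ->
  component H (L i) = L @: component G i.
Proof.
move=> no0; apply/setP => x; apply/idP/imsetP => [|[k]]; last first.
  by rewrite !inE => ik ->; apply: connect_lift.
rewrite inE => ix.
apply: (connect_invariant (D := fun z => exists2 k, k \in component G i & z = L k) ix).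
  by exists i => //; apply: comp_refl.
move=> u v _ [k ik ->]; case: (unliftP ord0 v) => [l|] -> a.
  by exists l => //; apply: (comp_adj ik); rewrite -adj_LL.
by move: (no0 k ik); rewrite a.
Qed.

Let comp_lift_notin0 i : ord0 \notin component H (L i) -> component H (L i) = L @: component G i.
Proof.
move=> no0; apply: comp_lift => k; rewrite inE => /connect_lift ik.
by apply: contra no0; apply: comp_adj; rewrite inE.
Qed.

Let comp_lift_sourceless i : [disjoint component G i & sources G] ->
  component H (L i) = L @: component G i.
Proof.
move=> dC; apply: comp_lift => k ik; rewrite adj_L0.
have noS x : x \in component G i -> x \notin sources G by move=> /(disjointFr dC) ->.
apply/norP; split; apply/eqP.
  by move/inn_sink; rewrite (negPf (sourceless_sink lagG noS ik)).
by move/outn_source; rewrite (negPf (noS _ ik)).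
Qed.

(** Vertex 0 attaches only to sinks and sources, and a component without sources has neither, so old
    cycles survive unchanged. *)
Let cycle_comps_ext :
  cycle_comps H :\ component H ord0 = [set L @: (C : {set 'I_n}) | C in cycle_comps G].
Proof.
apply/setP => C; rewrite in_setD1; apply/andP/imsetP => [[C0]|[C' + ->]].
  rewrite inE => /andP[/weak_componentsP[x eC] dC].
  have o0 : ord0 \notin C by apply: contra C0; rewrite eC => /comp_eq ->.
  case: (unliftP ord0 x) eC => [i|] -> eC; last by rewrite eC comp_refl in o0.
  have eC' : C = L @: component G i by rewrite eC comp_lift_notin0 // -eC.
  exists (component G i) => //; rewrite inE; apply/andP; split.
    by apply/weak_componentsP; exists i.
  apply/pred0P => k /=; apply/negP => /andP[ik sk].
  have Ck : L k \in C by rewrite eC' imset_f.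
  have := disjointFr dC Ck; rewrite source_extL sk /= => /negbFE/eqP E.
  case/negP: o0; move: Ck; rewrite eC => Ck; apply: (comp_adj Ck).
  by rewrite adj_L0 E eqxx orbT.
rewrite inE => /andP[/weak_componentsP[i ->] dC].
have eC := comp_lift_sourceless dC.
split.
  apply/eqP => e; have := comp_refl H ord0; rewrite -e => /imsetP[k _ e0].
  by have := neq_lift ord0 k; rewrite -e0 eqxx.
rewrite inE; apply/andP; split; first by apply/weak_componentsP; exists (L i).
apply/pred0P => x /=; apply/negP => /andP[/imsetP[k ik ->]].
by rewrite source_extL (disjointFr dC ik).
Qed.

Let comp0_cycle : (component H ord0 \in cycle_comps H) = closes.
Proof.
rewrite inE (_ : _ \in weak_components H = true) /=; last first.
  by apply/weak_componentsP; exists ord0.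
have mem0 := comp_refl H ord0.
rewrite /closes; case E : (c) => [[[i|] s]|]; last 2 first.
- apply/negP => /disjointFr/(_ mem0).
  by rewrite source_ext0 E.
- apply/pred0P => x /=; apply/negP => /andP[]; rewrite inE => x0.
  have -> : x = ord0.
    apply: (connect_invariant (D := fun z => z = ord0) x0) => // u v _ ->.
    by case: (unliftP ord0 v) => [l|] -> //; rewrite adj_0L E.
  by rewrite source_ext0 E.
have sinki : i \in sinks G by apply: inn_sink; rewrite E.
case: s E => [j|] E; last first.
  apply/negP => dC.
  have noS x : x \in component H ord0 -> x \notin sources H by move=> /(disjointFr dC) ->.
  have /sinkPn[y] := sourceless_sink lagH noS mem0.
  by case: (unliftP ord0 y) => [l|] ->; rewrite extE E.
have srcj : j \in sources G by apply: outn_source; rewrite E.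
(* On a cycle, the source of the path ending in [i] must lose that status, so it is [j]. Conversely
   the component is vertex 0 with the path of [i], whose only source [j] now has an in-neighbour. *)
apply/idP/idP => [dC|ij].
  have [a sa ia] := sinks_source lagG sinki.
  have a0 : L a \in component H ord0.
    rewrite inE; apply: connect_trans (connect_lift ia); apply: connect1.
    by rewrite adj_0L E eqxx.
  by have := disjointFr dC a0; rewrite source_extL sa E /= => /negbFE/eqP[->].
apply/pred0P => x /=; apply/negP => /andP[]; rewrite inE => x0.
have [->|[k [-> ik]]] : x = ord0 \/ exists k, x = L k /\ connect (weak_adj G) i k.
- apply: (connect_invariant (D := fun z => z = ord0 \/
     exists k, z = L k /\ connect (weak_adj G) i k) x0); first by left.
  move=> u v _ hu; case: (unliftP ord0 v) => [l|] -> uv; last by left.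
  right; exists l; split => //; case: hu uv => [->|[k [-> ik]]].
    by rewrite adj_0L E => /orP[]/eqP[<-].
  by rewrite adj_LL => kl; apply: (connect_trans ik); apply: connect1.
- by rewrite source_ext0 E.
rewrite source_extL E => /andP[sk /eqP]; apply; congr Some.
exact: (sources_connect_uniq lagG srcj sk ij ik).
Qed.

Lemma ncyc_ext : ncyc H = closes + ncyc G.
Proof.
rewrite !ncycE // (cardsD1 (component H ord0)) comp0_cycle cycle_comps_ext card_imset //.
exact/imset_inj/lift_inj.
Qed.

End Stats.

End Extension.

(** * The recurrence *)

Local Open Scope ring_scope.

Lemma npath_ext_cases n (G : digraph n) c : is_laguerre G -> attachable G c ->
  npath (ext G c) = match c with
    | Some (None, None) => (npath G).+1
    | Some (Some _, Some _) => (npath G).-1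
    | _ => npath G end.
Proof.
move=> lagG att; have := npath_ext lagG att.
by case: c att => [[[i|] [j|]]|] _ /=; lia.
Qed.

(** Induction on the deletion of vertex 0: the number of paths grows only when that vertex is
    isolated, and then it is a peak. *)
Lemma npath_le_npeak n (G : digraph n) : is_laguerre G -> (npath G <= npeak G)%N.
Proof.
elim: n G => [|n IH] G lagG.
  by rewrite npathE //; apply: leq_trans (max_card _) _; rewrite card_ord.
move: (lagG); rewrite -{1}(ext_restr lagG) ext_laguerre => /andP[lag' att].
have := npath_ext_cases lag' att; have := npeak_ext lag' att; have := IH _ lag'.
rewrite ext_restr // => h -> ->.
by case: (attach G) => [[[i|] [j|]]|] /=; lia.
Qed.

Lemma sum_option (V : nmodType) (T : finType) (Q : pred (option T)) (F : option T -> V) :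
  \sum_(c | Q c) F c = (if Q None then F None else 0) + \sum_(x | Q (Some x)) F (Some x).
Proof.
rewrite big_mkcond (bigD1 None) //=; congr (_ + _).
rewrite [RHS]big_mkcond (reindex_omap Some id) => [|[]] //=.
by apply: eq_bigl => x; rewrite eqxx.
Qed.

Lemma sum_attachable (V : nmodType) n (G : digraph n) (F : attachment n -> V) :
  \sum_(c | attachable G c) F c =
    F None + (F (Some (None, None))
    + \sum_(j in sources G) F (Some (None, Some j))
    + \sum_(i in sinks G) (F (Some (Some i, None))
                           + \sum_(j in sources G) F (Some (Some i, Some j)))).
Proof.
rewrite sum_option /=; congr (_ + _).
pose A p := if p is Some i then i \in sinks G else true.
pose B s := if s is Some j then j \in sources G else true.
transitivity (\sum_(p | A p) \sum_(s | B s) F (Some (p, s))).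
  rewrite (pair_big A B (fun p s => F (Some (p, s)))) /=.
  by apply: eq_big => -[p s].
rewrite sum_option /= sum_option /=; congr (_ + _).
by apply: eq_bigr => i _; rewrite sum_option.
Qed.

Section Recurrence.
Variables (R : comNzRingType) (lam yp yv yda ydd yfp : R).

(** With [npath G] in place of [k], the weight is independent of the column, which survives only as
    an indicator. *)
Definition wt n (G : digraph n) : R :=
  yp ^+ (npeak G - npath G) * yv ^+ nvalley G * yda ^+ ndasc G * ydd ^+ nddesc G
    * yfp ^+ nfix G * lam ^+ ncyc G.

Lemma lflatE n k : lflat lam yp yv yda ydd yfp n k =
  \sum_(G : digraph n | is_laguerre G) wt G *+ (npath G == k).
Proof.
rewrite /lflat big_mkcond [RHS]big_mkcond; apply: eq_bigr => G _; rewrite inE.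
by case: (is_laguerre G) => //=; rewrite /wt; case: eqP => [->|_].
Qed.

Lemma lhat_lflat n k : lhat lam yp yv yda ydd yfp n k =
  yp ^+ k * lflat lam yp yv yda ydd yfp n k.
Proof.
rewrite /lhat /lflat big_distrr; apply: eq_bigr => G /=.
rewrite inE => /andP[/npath_le_npeak + /eqP e]; rewrite e => ke.
by rewrite !mulrA -exprD subnKC.
Qed.

(** An isolated vertex adds a peak and a path, leaving the exponent of [yp] fixed. A valley removes
    a path but no peak, whence the factor [yp] beside [yv]. *)
Let wt_ext n (G : digraph n) c : is_laguerre G -> attachable G c ->
  wt (ext G c) = wt G * match c with
    | None => lam * yfp
    | Some (None, None) => 1
    | Some (None, Some _) => yda
    | Some (Some _, None) => ydd
    | Some (Some i, Some j) =>
        yp * yv * (if connect (weak_adj G) i j then lam else 1) end.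
Proof.
move=> lagG att; rewrite /wt npeak_ext // nvalley_ext // ndasc_ext // nddesc_ext //.
rewrite nfix_ext // ncyc_ext // npath_ext_cases // /closes.
have := npath_le_npeak lagG.
have /andP[a1 a2] := att.
move: (npeak G) (npath G) (npathE lagG) => p k ek.
move: (nvalley G) (ndasc G) (nddesc G) (nfix G) (ncyc G) => v da dd f cy.
case: c att a1 a2 => [[[i|] [j|]]|] _ /= a1 a2 kp; rewrite ?add0n ?add1n ?subSS.
  have -> : (p - k.-1 = (p - k).+1)%N.
    have : (0 < k)%N by rewrite ek; apply/card_gt0P; exists j.
    by lia.
  case: ifP => _; rewrite ?add1n ?add0n !exprS.
all: rewrite ?exprS.
all: move: (yp ^+ (p - k)) (yv ^+ v) (yda ^+ da) (ydd ^+ dd) (yfp ^+ f) (lam ^+ cy) => *.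
all: ring.
Qed.

(** With k paths there are k ways to attach a double ascent and k for a double descent. With k + 1
    paths, each of the k + 1 sinks closes a cycle with its own source, weight [lam], and merges with
    each of the k others, weight 1. *)
Lemma sum_wt_ext n (G : digraph n) k : is_laguerre G ->
  \sum_(c | attachable G c) wt (ext G c) *+ (npath (ext G c) == k) =
  wt G *+ ((npath G).+1 == k)
  + (lam * yfp + (yda + ydd) *+ k) * (wt G *+ (npath G == k))
  + yp * yv * (lam + k%:R) * (wt G *+ (npath G == k.+1) *+ k.+1).
Proof.
move=> lagG.
under eq_bigr => c att do rewrite npath_ext_cases // wt_ext //.
rewrite sum_attachable.
rewrite sumr_const big_split /= sumr_const -npathE // card_sinks // -npathE //.
have -> : \sum_(i in sinks G) \sum_(j in sources G)
    (wt G * (yp * yv * (if connect (weak_adj G) i j then lam else 1)))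
       *+ ((npath G).-1 == k) =
    yp * yv * (lam + k%:R) * (wt G *+ (npath G == k.+1) *+ k.+1).
  transitivity (\sum_(i in sinks G) (wt G * (yp * yv * (lam + (npath G).-1%:R)))
       *+ ((npath G).-1 == k)).
    apply: eq_bigr => i si; rewrite sumrMnl -!big_distrr /=; congr (_ * (_ * _) *+ _).
    have [a sa ia] := sinks_source lagG si.
    rewrite (bigD1 a) //= ia; congr (_ + _).
    rewrite (eq_bigr (fun=> 1)) => [|j /andP[sj ja]]; last first.
      case: ifP => // ij; case/eqP: ja; exact: (sources_connect_uniq lagG sj sa ij ia).
    rewrite sumr_const; congr (_%:R).
    rewrite npathE // (cardsD1 a) sa /=; apply: eq_card => j.
    by rewrite in_setD1 -topredE /= andbC.
  rewrite sumr_const card_sinks // -npathE //.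
  case: (npath G) => [|p] /=; first by rewrite mulr0n !mul0rn mulr0.
  by rewrite eqSS; case: eqP => [->|_]; rewrite ?mulr1n ?mulr0n ?mul0rn ?mulr0 //; ring.
case: (eqVneq (npath G) k) => [->|ne].
  by rewrite !mulr1n; ring.
by rewrite !mulr0n !mul0rn !mulr0; ring.
Qed.

Lemma lflat_rec :
  lag_rec (yda + ydd) (lam * yfp) (yp * yv) lam (lflat lam yp yv yda ydd yfp).
Proof.
split=> [k|n k].
  rewrite lflatE (big_pred1 set0) => [|G]; last first.
    have -> : G = set0 by apply/setP => -[[]].
    by rewrite /= eqxx; apply/laguerreP; split; case.
  have c0 (A : {set 'I_0}) : #|A| = 0%N by apply: eq_card0 => -[].
  rewrite /wt npathE; last by apply/laguerreP; split; case.
  rewrite /npeak /nvalley /ndasc /nddesc /nfix !c0.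
  rewrite ncycE; last by apply/laguerreP; split; case.
  rewrite (_ : #|cycle_comps _| = 0%N) ?expr0 ?mulr1 ?(eq_sym 0%N) //.
  by apply: eq_card0 => C; rewrite inE; apply/negP => /andP[/weak_componentsP[[]]].
rewrite lflatE (reindex_onto (fun Gc => ext Gc.1 Gc.2) (fun G => (restr G, attach G)))
  => [|G lagG] /=; last exact: ext_restr.
rewrite (eq_bigl (fun Gc => is_laguerre Gc.1 && attachable Gc.1 Gc.2)) => [|[G c]]; last first.
  by rewrite /= ext_laguerre restr_ext attach_ext eqxx andbT.
rewrite -(pair_big_dep (@is_laguerre n) (@attachable n)
   (fun G c => wt (ext G c) *+ (npath (ext G c) == k))) /=.
under eq_bigr => G lagG do rewrite sum_wt_ext //.
rewrite !big_split /= -!big_distrr /= sumrMnl -!lflatE; congr (_ + _ + _).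
case: k => [|k]; first by rewrite big1.
by rewrite lflatE.
Qed.

End Recurrence.

Lemma laguerre_lag_pos (R : comNzRingType) (P : R -> Prop) (lam yp yv yda ydd yfp : R) :
  laguerre_hyp P lam yp yv yda ydd yfp ->
  lag_pos P (yda + ydd) (lam * yfp) (yp * yv) lam.
Proof. by rewrite /laguerre_hyp /cone_le !subr0 => -[*]; exists yp, yv. Qed.

Theorem theorem1p4 (R : comNzRingType) (P : R -> Prop)
    (lam yp yv yda ydd yfp : R) :
  ordered_cone P ->
  laguerre_hyp P lam yp yv yda ydd yfp \/
  laguerre_hyp P lam yv yp yda ydd yfp ->
  [/\ totally_positive P (lflat lam yp yv yda ydd yfp),
      totally_positive (coefwise P)
        (lt_mul (fun n k => (lflat lam yp yv yda ydd yfp n k)%:P)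
                (binomial_mx R)),
      hankel_totally_positive (coefwise P) (Lhat_row lam yp yv yda ydd yfp)
    & hankel_totally_positive (coefwise P)
        (Lhat_row_rev lam yp yv yda ydd yfp)].
Proof.
move=> HP hyp.
have rec := lflat_rec lam yp yv yda ydd yfp.
have pos : lag_pos P (yda + ydd) (lam * yfp) (yp * yv) lam.
  by case: hyp => /laguerre_lag_pos //; rewrite (mulrC yp).
have Pyp : P yp by move: hyp; rewrite /laguerre_hyp /cone_le !subr0 => -[] [].
split.
- exact (tp_lag_rec HP pos rec).
- exact: tp_lag_rec_binomial HP pos rec.
- apply: (tp_ext (hankel_row_poly HP pos rec Pyp)) => i j.
  by apply: eq_bigr => k _; rewrite lhat_lflat.
- apply: (tp_ext (hankel_row_poly_rev HP pos rec Pyp)) => i j.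
  by apply: eq_bigr => k _; rewrite lhat_lflat.
Qed.
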